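(* Consider the problem of learning non-sparse parities with noise in dimension $D$ with signal-to-noise ratio $\Lambda$ satisfying $\Lambda^2 \asymp D^{-\gamma}$ (as $D \to \infty$). Let $\hat S$ be any estimator of $S$ computed using a memory bounded estimation algorithm with resource profile $(N,T,s)$ scaling with $D$ as $$N\Lambda^2 \asymp D^{\eta}, \quad T \asymp D^{\tau}, \quad s \asymp \frac{D^{\mu}}{\Lambda^{\alpha}}$$ for any constants $\eta \geq 1$, $\tau \geq 0$, $\mu \geq 0$, $\alpha < 4/3$. If $$\gamma > \frac{2(\eta + \tau + \mu + 2)}{4/3 - \alpha},$$ then $$\lim_{D \to \infty}\ \inf_{S \subset [D]} \mathbb{P}_S\left(S = \hat S\right) = 0.$$
   Context: **Learning (non-sparse) parities with noise.** For an unknown $S \subset [D]$ and $\Lambda \in [0,1]$, one observes $N$ i.i.d. feature–response pairs $(\boldsymbol f_i, r_i) \in \mathbb{R}^D \times \{0,1\}$ with $$\boldsymbol f_i \sim \mathcal{N}(\boldsymbol 0, \boldsymbol I_D), \qquad r_i \mid \boldsymbol f_i \sim \mathrm{Bernoulli}\left(\frac12 + \frac{\Lambda}{2} \prod_{j \in S} \mathrm{sign}(f_{ij})\right).$$ $\mathbb{P}_S$ denotes probability when the data are generated with parameter $S$. The goal is to estimate $S$. **Memory bounded estimation algorithm with resource profile $(N,T,s)$.** Such an algorithm makes $T$ passes over a dataset of $N$ samples $\boldsymbol x_1, \dots, \boldsymbol x_N \in \mathcal{X}$ (here $\boldsymbol x_i = (\boldsymbol f_i, r_i)$) using a memory state of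 $s$ bits, initially all zeros. It is specified by arbitrary update functions $f_{t,i} : \{0,1\}^s \times \mathcal{X} \to \{0,1\}^s$ ($t \in [T]$, $i \in [N]$) and an arbitrary estimator function $g$ on $\{0,1\}^s$. For $t = 1,\dots,T$ in order, and within each pass for $i = 1,\dots,N$ in order, the state is updated by $\mathtt{state} \leftarrow f_{t,i}(\mathtt{state}, \boldsymbol x_i)$. After all $T$ passes the output is $g(\mathtt{state})$ (here $\hat S$). **Asymptotic notation.** For non-negative sequences indexed by $D$, $a_D \lesssim b_D$ means $\limsup_{D\to\infty} a_D/b_D < \infty$; $a_D \asymp b_D$ means $a_D \lesssim b_D$ and $b_D \lesssim a_D$. *)

(* Defs.v *)
From HB Require Import structures.
From mathcomp Require Import all_boot all_order all_algebra.
From mathcomp Require Import all_classical all_reals all_analysis.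
From mathcomp Require Import measurable_realfun.

Set Implicit Arguments.
Unset Strict Implicit.
Unset Printing Implicit Defensive.

Import Order.TTheory GRing.Theory Num.Theory.
Import numFieldNormedType.Exports.

Local Open Scope classical_set_scope.
Local Open Scope ring_scope.

Section asymptotics.
Context {R : realType}.
Implicit Types a b : nat -> R.

(* The quotient is taken in [\bar R], where c / 0 = +oo for c > 0 and
   0 / 0 = 0; the total real division, with c / 0 = 0, would make any
   sequence asymptotically dominated by 0. *)
Definition asymp_le a b : Prop :=
  (limn_esup (fun D => (a D)%:E / (b D)%:E) < +oo)%E.

Definition asymp_eq a b : Prop := asymp_le a b /\ asymp_le b a.

End asymptotics.

Section kernel_joint.
Context d1 d2 (T1 : measurableType d1) (T2 : measurableType d2)
  (R : realType) (P : probability T1 R) (k : R.-pker T1 ~> T2).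
Local Open Scope ereal_scope.

(* The law of (x, y) when x ~ P and, conditionally on x, y ~ k x. *)
Definition joint_law (A : set (T1 * T2)) : \bar R :=
  \int[P]_x k x (xsection A x).

Let joint0 : joint_law set0 = 0.
Proof. by rewrite [LHS]integral0_eq// => x _; rewrite xsection0. Qed.

Let joint_ge0 A : 0 <= joint_law A.
Proof. exact: integral_ge0. Qed.

Let joint_sigma_additive : semi_sigma_additive joint_law.
Proof.
move=> F mF tF mUF.
rewrite [X in _ --> X](_ : _ = \sum_(n <oo) joint_law (F n)).
  apply/cvg_closeP; split; last by rewrite closeE.
  by apply: is_cvg_nneseries => n _ _; exact: joint_ge0.
rewrite -integral_nneseries//; last first.
  by move=> n; apply: measurable_fun_xsection_finite_kernel; rewrite inE.
apply: eq_integral => x _; apply/esym/cvg_lim => //=; rewrite xsection_bigcup.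
apply: (measure_sigma_additive _ (trivIset_xsection tF)) => ?.
exact: measurable_xsection.
Qed.

HB.instance Definition _ := isMeasure.Build _ _ _ joint_law
  joint0 joint_ge0 joint_sigma_additive.

Let joint_setT : joint_law setT = 1.
Proof.
rewrite /joint_law (eq_integral (cst 1)); last first.
  by move=> x _; rewrite xsectionE/= preimage_setT prob_kernel.
by rewrite integral_cst// mul1e; exact: probability_setT.
Qed.

HB.instance Definition _ :=
  @Measure_isProbability.Build _ _ R joint_law joint_setT.

End kernel_joint.

Section product_prob.
Context d1 d2 (T1 : measurableType d1) (T2 : measurableType d2) (R : realType)
  (P : probability T1 R) (Q : probability T2 R).
Local Open Scope ereal_scope.

Definition product_prob : set (T1 * T2) -> \bar R := P \x Q.

HB.instance Definition _ := Measure.on product_prob.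

Let product_prob_setT : product_prob setT = 1.
Proof.
rewrite -setXTT /product_prob product_measure1E// -[RHS]mule1.
by congr mule; exact: probability_setT.
Qed.

HB.instance Definition _ :=
  @Measure_isProbability.Build _ _ R product_prob product_prob_setT.

End product_prob.

Section iid.
Context d (T : measurableType d) (R : realType) (P : probability T R).

Definition tuple_cons n (z : T * n.-tuple T) : n.+1.-tuple T :=
  [the n.+1.-tuple T of z.1 :: z.2].

Let measurable_tuple_cons n : measurable_fun setT (@tuple_cons n).
Proof. exact: measurable_cons. Qed.

HB.instance Definition _ n :=
  isMeasurableFun.Build _ _ _ _ (@tuple_cons n) (@measurable_tuple_cons n).

(* The n-fold product measure of P; see [iid_probE]. *)
Fixpoint iid_prob n : probability (n.-tuple T) R :=
  if n is m.+1 return probability (n.-tuple T) R then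
    distribution (product_prob P (iid_prob m)) (@tuple_cons m)
  else \d_[tuple].

Lemma iid_probE n (A : 'I_n -> set T) : (forall i, measurable (A i)) ->
  iid_prob n [set x | forall i, A i (tnth x i)] = (\prod_(i < n) P (A i))%E.
Proof.
elim: n A => [|n IH] A mA.
  by rewrite big_ord0/= diracE mem_set//= => i; case: (i).
rewrite big_ord_recl/= -IH//.
rewrite /distribution /pushforward.
have -> : @tuple_cons n @^-1` [set x | forall i, A i (tnth x i)] =
  A ord0 `*` [set x | forall i, A (lift ord0 i) (tnth x i)].
  apply/seteqP; split => [[x y]/= H|[x y]/= [Hx Hy] i].
    split; first by have := H ord0; rewrite tnth0.
    by move=> i; have := H (lift ord0 i); rewrite tnthS.
  by case: (unliftP ord0 i) => [j ->|->]; rewrite ?tnthS ?tnth0.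
rewrite /product_prob product_measure1E//.
rewrite [X in measurable X](_ : _ =
  \bigcap_(i in [set: 'I_n]) ((@tnth _ T ^~ i) @^-1` A (lift ord0 i))); last first.
  by apply/seteqP; split => x /= H i; [move=> _; exact: H|exact: H].
apply: fin_bigcap_measurable => // i _.
by rewrite -[X in measurable X]setTI; exact: measurable_tnth.
Qed.

End iid.

(* [measurableTypeR R] is R with its Borel sigma-algebra: the type on which
   the library defines [normal_prob]. *)
Notation features R D := (D.-tuple (measurableTypeR R)).

Section parity_model.
Context {R : realType} (D : nat).
Implicit Types (Lambda : R) (S : {set 'I_D}) (f : features R D).

Definition parity_bias Lambda S f : R :=
  2^-1 + Lambda / 2 * \prod_(j in S) Num.sg (tnth f j : R).

Lemma measurable_parity_bias Lambda S :
  measurable_fun setT (parity_bias Lambda S).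
Proof.
apply: measurable_funD => //; apply: measurable_funM => //.
under eq_fun do rewrite -big_enum/=.
apply: measurable_prod => j _.
rewrite (_ : (fun _ => _) = (fun x : measurableTypeR R =>
    if x == 0 :> R then 0 : R else if (x : R) < 0 then -1 else 1) \o
  (fun f : features R D => tnth f j)).
  apply: measurableT_comp; last exact: measurable_tnth.
  apply: measurable_fun_ifT => //; first exact: measurable_fun_eqr.
  by apply: measurable_fun_ifT => //; exact: measurable_fun_ltr.
apply/funext => f /=; rewrite sgr_def.
by case: ltrgt0P; rewrite ?mulr1n ?mulr0n.
Qed.

Definition parity_label Lambda S : R.-pker (features R D) ~> bool :=
  kprobability (measurableT_comp measurable_bernoulli_prob
                                 (measurable_parity_bias Lambda S)).

Definition std_gaussian : probability (features R D) R :=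
  iid_prob (normal_prob 0 1) D.

Definition parity_sample Lambda S : probability (features R D * bool)%type R :=
  joint_law std_gaussian (parity_label Lambda S).

Definition parity_data Lambda S (N : nat) :
    probability (N.-tuple (features R D * bool)) R :=
  iid_prob (parity_sample Lambda S) N.

End parity_model.

(* Each update is required to be measurable in the sample, so that the events
   {estimate = S} have a probability; [estimator] is unrestricted. *)
Record mb_algorithm d (X : measurableType d) (Out : Type) (N T s : nat) :=
  MbAlgorithm {
    update : 'I_T -> 'I_N -> s.-tuple bool -> X -> s.-tuple bool;
    estimator : s.-tuple bool -> Out;
    measurable_update : forall t i state,
      measurable_fun [set: X] (update t i state)
  }.

Section mb_run.
Context d (X : measurableType d) (Out : Type) (N T s : nat)
  (alg : mb_algorithm X Out N T s) (x : N.-tuple X).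

Definition pass (t : 'I_T) (state : s.-tuple bool) : s.-tuple bool :=
  foldl (fun st i => update alg t i st (tnth x i)) state (enum 'I_N).

Definition final_state : s.-tuple bool :=
  foldl (fun st t => pass t st) [tuple of nseq s false] (enum 'I_T).

Definition mb_output : Out := estimator alg final_state.

End mb_run.

(* Main.v *)
Require Import Defs.
From HB Require Import structures.
From mathcomp Require Import all_boot all_order all_algebra.
From mathcomp Require Import all_classical all_reals all_analysis.
From mathcomp Require Import measurable_realfun.
From mathcomp Require Import ring lra zify.

Set Implicit Arguments.
Unset Strict Implicit.
Unset Printing Implicit Defensive.

Import Order.TTheory GRing.Theory Num.Theory.

Local Open Scope ring_scope.

(** Under the worst hypothesis an algorithm succeeds at most as often as on
average over all 2^D hypotheses S, so it suffices to bound that average.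
Compare each law P_S with the null law P_0 in which the labels are fair coins
independent of the features.  Under P_0 the output equals S with probability
2^-D on average over S; hence it is enough that, for most S, the memory of
the algorithm has nearly the same law under P_S as under P_0.

The Gaussian features enter only through their signs: conditionally on their
absolute values the sign pattern is uniform, and the label depends on it
through the parity chi_S alone ([parity_sampleE]).  Fixing the absolute values
at their worst ([iid_sum_le], [worst_success_le]) leaves a finite problem about
uniform sign patterns.

Cut the N samples into m blocks of n consecutive samples, and call transcript
the list of the memory states at the block boundaries in all T passes.  The
blocks compatible with a transcript form a product set, so the likelihood
ratio of the transcript is the product over the blocks of conditional
likelihoods L_j, and the relative entropy from P_0 to P_S is the sum over j of
E_0 (L_j - 1 - ln L_j).  Up to a negligible tail, each summand is at most
2 E_0 (1 - L_j)^2 ([likelihood_event_le]).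

It remains to bound E_0 (1 - L_j)^2 on average over S for one block, from
which the algorithm extracts only s T bits ([card_block_transcripts]).  Expand
the likelihood ratio of the block into monomials: a set I of samples
contributes Lambda^|I| times the product over i in I of label i and
chi_S (f_i).  Averaging over S makes different I orthogonal, except for
coincidences between features of probability 2^-D.  At degrees one and two the
level-1 inequality and an entropy bound show that s T bits reveal at most a
multiple of Lambda^2 s T ([avg_low_part_sqr]).  Degrees three and more
contribute at most a multiple of (n Lambda^2)^3, whatever the algorithm does
([sum_high_degree]).

With n of order D^(2 gamma / 3), that is Lambda^(-4/3), the last quantity has
order Lambda^2, and there are at most about D^(eta + gamma / 3) blocks.  The
total is at most about D^(eta + tau + mu - gamma (4/3 - alpha) / 2), which the
hypothesis on gamma makes tend to 0 ([total_error_le]). *)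

(** * Uniform averages and conditional averages *)

Section averages.
Context {R : realType}.

(** On an empty type this is 0, so that linearity, monotonicity and exchange
hold unconditionally; only the average of a constant needs a point. *)
Definition avg (T : finType) (f : T -> R) : R := #|T|%:R^-1 * \sum_x f x.

Lemma card_gt0R (T : finType) (x : T) : 0 < #|T|%:R :> R.
Proof. by rewrite ltr0n; apply/card_gt0P; exists x. Qed.

Lemma eq_avg (T : finType) (f g : T -> R) : f =1 g -> avg f = avg g.
Proof. by move=> fg; rewrite /avg; under eq_bigr do rewrite fg. Qed.

Lemma avgD (T : finType) (f g : T -> R) :
  avg (fun x => f x + g x) = avg f + avg g.
Proof. by rewrite /avg big_split mulrDr. Qed.

Lemma avgN (T : finType) (f : T -> R) : avg (fun x => - f x) = - avg f.
Proof. by rewrite /avg sumrN mulrN. Qed.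

Lemma avgB (T : finType) (f g : T -> R) :
  avg (fun x => f x - g x) = avg f - avg g.
Proof. by rewrite avgD avgN. Qed.

Lemma avgZ (T : finType) a (f : T -> R) : avg (fun x => a * f x) = a * avg f.
Proof. by rewrite /avg -mulr_sumr mulrCA. Qed.

Lemma avg_sum (T : finType) I (r : seq I) (P : pred I) (F : I -> T -> R) :
  avg (fun x => \sum_(i <- r | P i) F i x) = \sum_(i <- r | P i) avg (F i).
Proof. by rewrite /avg exchange_big/= mulr_sumr. Qed.

Lemma avg_exchange (T T' : finType) (F : T -> T' -> R) :
  avg (fun x => avg (F x)) = avg (fun y => avg (F^~ y)).
Proof. by rewrite {1}/avg -avg_sum -avgZ. Qed.

Lemma ler_avg (T : finType) (f g : T -> R) :
  (forall x, f x <= g x) -> avg f <= avg g.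
Proof. by move=> fg; rewrite ler_wpM2l ?invr_ge0// ler_sum. Qed.

Lemma avg_ge0 (T : finType) (f : T -> R) : (forall x, 0 <= f x) -> 0 <= avg f.
Proof. by move=> f0; rewrite mulr_ge0 ?invr_ge0 ?sumr_ge0. Qed.

Lemma avg_cst (T : finType) (x0 : T) (c : R) : avg (fun _ : T => c) = c.
Proof.
rewrite /avg sumr_const -[c *+ _]mulr_natl mulKf// gt_eqF//.
exact: card_gt0R x0.
Qed.

Lemma avg_le_cst (T : finType) (f : T -> R) (c : R) : 0 <= c ->
  (forall x, f x <= c) -> avg f <= c.
Proof.
move=> c0 fc; case: (pickP (@predT T)) => [x0 _|T0].
  by rewrite -[leRHS](avg_cst x0); apply: ler_avg.
by rewrite /avg (eq_card0 T0) invr0 mul0r.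
Qed.

Lemma avg_bij (T T' : finType) (h : T' -> T) (f : T -> R) :
  bijective h -> avg (f \o h) = avg f.
Proof.
move=> hbij; rewrite /avg [in RHS](reindex h)/=; last exact: onW_bij.
by rewrite (bij_eq_card hbij).
Qed.

Lemma avg_pair (T T' : finType) (f : T * T' -> R) :
  avg f = avg (fun x => avg (fun y => f (x, y))).
Proof.
rewrite /avg card_prod natrM invfM -mulrA; congr (_ * _).
rewrite -mulr_sumr; congr (_ * _).
by rewrite pair_big/=; apply: eq_bigr => -[].
Qed.

Lemma avg_prod (I T : finType) (f : I -> T -> R) :
  avg (fun x : {ffun I -> T} => \prod_i f i (x i)) = \prod_i avg (f i).
Proof.
rewrite /avg big_split/= bigA_distr_bigA/=; congr (_ * _).
by rewrite card_ffun natrX -exprVn prodr_const.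
Qed.

End averages.

Section cond_average.
Context {R : realType} (T : finType).
Implicit Types (A : {pred T}) (f g : T -> R).

Definition cond_avg A f : R := #|A|%:R^-1 * \sum_(x in A) f x.

Lemma ler_cond_avg A f g : {in A, forall x, f x <= g x} -> cond_avg A f <= cond_avg A g.
Proof. by move=> fg; rewrite ler_wpM2l ?invr_ge0// ler_sum. Qed.

Lemma cond_avg_cst A (x0 : T) c : x0 \in A -> cond_avg A (fun=> c) = c.
Proof.
move=> Ax0; rewrite /cond_avg sumr_const -[c *+ _]mulr_natl mulKf// pnatr_eq0.
by apply/eqP => /card0_eq/(_ x0); rewrite Ax0.
Qed.

Lemma cond_avgD A f g : cond_avg A (fun x => f x + g x) = cond_avg A f + cond_avg A g.
Proof. by rewrite /cond_avg big_split mulrDr. Qed.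

Lemma cond_avgZ A a f : cond_avg A (fun x => a * f x) = a * cond_avg A f.
Proof. by rewrite /cond_avg -mulr_sumr mulrCA. Qed.

Lemma cond_avg_sum A I (r : seq I) (P : pred I) (F : I -> T -> R) :
  cond_avg A (fun x => \sum_(i <- r | P i) F i x) =
  \sum_(i <- r | P i) cond_avg A (F i).
Proof. by rewrite /cond_avg exchange_big/= mulr_sumr. Qed.

Lemma cond_avg_abs_le1 A f : (forall x, `|f x| <= 1) -> `|cond_avg A f| <= 1.
Proof.
move=> f1; case: (pickP A) => [x0 Ax0|A0]; last first.
  by rewrite /cond_avg (eq_card0 A0) invr0 mul0r normr0.
rewrite -(cond_avg_cst 1 Ax0) /cond_avg normrM ger0_norm ?invr_ge0// ler_wpM2l ?invr_ge0//.
by apply: le_trans (ler_norm_sum _ _ _) _; apply: ler_sum.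
Qed.

End cond_average.

Section fiber_average.
Context {R : realType} (Y W : finType) (G : Y -> W).

(** The tower property of conditioning on [G]. *)
Lemma avg_fiber (h : Y -> R) (c : W -> R) :
  avg (fun y => cond_avg [pred y' | G y' == G y] h * c (G y)) =
  avg (fun y => h y * c (G y)).
Proof.
rewrite /avg; congr (_ * _).
rewrite (partition_big G predT)// [RHS](partition_big G predT)//=.
apply: eq_bigr => w _.
rewrite (eq_bigr (fun=> cond_avg [pred y' | G y' == w] h * c w)); last first.
  by move=> y /eqP ->.
rewrite [RHS](eq_bigr (fun y => h y * c w)); last by move=> y /eqP ->.
rewrite -[LHS]mulr_suml -[RHS]mulr_suml; congr (_ * _); rewrite sumr_const -[LHS]mulr_natl.
case: (pickP (fun y => G y == w)) => [y0 y0w|w0]; last first.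
  by rewrite !big_pred0// eq_card0// mul0r.
rewrite /cond_avg mulVKf // pnatr_eq0; apply/eqP => /card0_eq/(_ y0).
by move=> /(etrans (esym y0w)); rewrite inE.
Qed.

End fiber_average.

(** * What few bits reveal about independent signs *)

Section log_ineq.
Context {R : realType}.

Lemma ln1D_ge (u : R) : - 2^-1 <= u -> u - 2 * u ^+ 2 <= ln (1 + u).
Proof.
move=> u2; have u1 : 0 < 1 + u by lra.
have -> : 1 + u = (1 + (- u / (1 + u)))^-1 by field; lra.
have h : 1 + (- u / (1 + u)) = (1 + u)^-1 by field; lra.
rewrite lnV ?posrE ?h ?invr_gt0// -h.
apply: (@le_trans _ _ (u / (1 + u))); last first.
  rewrite lerNr -mulNr; apply: le_ln1Dx.
  by rewrite -subr_gt0 opprK addrC h invr_gt0.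
rewrite ler_pdivlMr//.
have : 0 <= u ^+ 2 * (1 + 2 * u) by rewrite mulr_ge0 ?sqr_ge0//; lra.
lra.
Qed.

Lemma ln_le_tangent (t x : R) : 0 < t -> 0 < x -> ln x <= ln t + (x / t - 1).
Proof.
move=> t0 x0; have xt0 : 0 < x / t by rewrite divr_gt0.
rewrite -lerBlDl -ln_div ?posrE// -[X in ln X](subrKC 1).
by apply: le_ln1Dx; rewrite ltrBrDl addrN.
Qed.

Lemma ln_prod I (s : seq I) (F : I -> R) : (forall i, 0 < F i) ->
  ln (\prod_(i <- s) F i) = \sum_(i <- s) ln (F i).
Proof.
move=> F0; elim: s => [|i s IH]; first by rewrite !big_nil ln1.
by rewrite !big_cons lnM ?posrE ?prodr_gt0// IH.
Qed.

End log_ineq.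

Section level1.
Context {R : realType} (Y : finType) (K : eqType).
Variables (s : seq K) (z : K -> Y -> R) (flip : K -> Y -> Y).
Hypotheses (us : uniq s) (flipK : forall k, involutive (flip k)).
Hypothesis z_flip : forall k l, k \in s -> l \in s -> forall y,
  z l (flip k y) = if l == k then - z l y else z l y.
Hypothesis z_pm1 : forall k y, `|z k y| <= 1.

(** Each [flip k] reverses [z k] and preserves the other signs, so [z k] averages
to 0 against any product of the others and only the constant term survives.
Flips express independence of the signs in a form that holds both for the
labels of a block and for their products with one fixed label. *)
Lemma avg_prod_flip (lambda : K -> R) (y0 : Y) :
  avg (fun y => \prod_(k <- s) (1 + lambda k * z k y)) = 1.
Proof.
elim: s us z_flip => [_ _|k t IH /= /andP[kt ut] zf].
  by under eq_avg do rewrite big_nil; rewrite (avg_cst y0).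
have zft k' l : k' \in t -> l \in t -> forall y,
    z l (flip k' y) = if l == k' then - z l y else z l y.
  by move=> ? ?; apply: zf; rewrite inE; apply/orP; right.
under eq_avg do rewrite big_cons mulrDl mul1r -mulrA.
rewrite avgD (IH ut zft) avgZ.
set a := avg _; suff h : a = - a by rewrite (_ : a = 0) ?mulr0 ?addr0//; lra.
rewrite {1}/a -(avg_bij _ (inv_bij (flipK k))) -avgN.
apply: eq_avg => y /=; rewrite zf ?mem_head// eqxx mulNr; congr (- (_ * _)).
apply: eq_big_seq => l lt; rewrite zf ?mem_head ?inE ?lt ?orbT//.
by case: eqP => // lk; rewrite -lk lt in kt.
Qed.

(** The product of the [1 + lambda k * z k] averages to 1, so by Jensen its
logarithm averages to at most [ln (1 / P A)] on [A]; it also averages to at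
least the sum of the [lambda k * e k - 2 * lambda k ^+ 2], where [e k] is the
conditional average of [z k].  Taking [lambda k = e k / 4] gives the bound. *)
Lemma level1_inequality (A : {pred Y}) (y0 : Y) : y0 \in A ->
  \sum_(k <- s) cond_avg A (z k) ^+ 2 <= 8 * ln (#|Y|%:R / #|A|%:R).
Proof.
move=> Ay0; pose lambda k := 4^-1 * cond_avg A (z k).
have A0 : 0 < #|A|%:R :> R by rewrite ltr0n; apply/card_gt0P; exists y0.
have Y0 : 0 < #|Y|%:R :> R by exact: card_gt0R y0.
set t := #|Y|%:R / #|A|%:R; have t0 : 0 < t by rewrite divr_gt0.
have cz k : `|cond_avg A (z k)| <= 1 by exact/cond_avg_abs_le1/z_pm1.
have lz k y : `|lambda k * z k y| <= 4^-1.
  rewrite normrM /lambda normrM ger0_norm ?invr_ge0//.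
  rewrite -mulrA -[leRHS]mulr1 ler_wpM2l ?invr_ge0//.
  by rewrite mulr_ile1// z_pm1.
have lz2 k y : - 4^-1 <= lambda k * z k y.
  by have := lz k y; rewrite ler_norml => /andP[].
have F0 y k : 0 < 1 + lambda k * z k y by have := lz2 k y; lra.
pose Pi y := \prod_(k <- s) (1 + lambda k * z k y).
have Pi0 y : 0 < Pi y by exact: prodr_gt0.
have up : cond_avg A (fun y => ln (Pi y)) <= ln t.
  apply: (@le_trans _ _ (cond_avg A (fun y => ln t - 1 + t^-1 * Pi y))).
    apply: ler_cond_avg => y _; rewrite -addrA [-1 + _]addrC [t^-1 * _]mulrC.
    exact: ln_le_tangent.
  rewrite cond_avgD cond_avgZ (cond_avg_cst _ Ay0) -addrA gerDl addrC subr_le0.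
  have -> : t^-1 * cond_avg A Pi = #|Y|%:R^-1 * \sum_(y in A) Pi y.
    by rewrite /t /cond_avg; field; rewrite !gt_eqF.
  apply: (@le_trans _ _ (avg Pi)); last by rewrite avg_prod_flip.
  rewrite /avg ler_wpM2l ?invr_ge0// [leRHS](bigID (mem A))/= lerDl.
  by apply: sumr_ge0 => y _; exact: ltW.
have lo : 8^-1 * (\sum_(k <- s) cond_avg A (z k) ^+ 2) <= cond_avg A (fun y => ln (Pi y)).
  rewrite mulr_sumr.
  apply: (@le_trans _ _ (cond_avg A (fun y =>
      \sum_(k <- s) (lambda k * z k y - 2 * lambda k ^+ 2)))); last first.
    apply: ler_cond_avg => y _; rewrite ln_prod//.
    apply: ler_sum => k _; apply: (le_trans _ (ln1D_ge _)); last first.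
      by have := lz2 k y; lra.
    rewrite lerD2l lerN2 ler_wpM2l// exprMn.
    rewrite ler_piMr ?sqr_ge0// -[leRHS](expr1n _ 2).
    by rewrite -[leLHS]real_normK ?num_real// lerXn2r ?nnegrE//.
  rewrite cond_avg_sum; apply: ler_sum => k _.
  rewrite cond_avgD cond_avgZ (cond_avg_cst _ Ay0) /lambda; lra.
have := le_trans lo up; lra.
Qed.

End level1.

Section entropy.
Context {R : realType} (Y W : finType) (G : Y -> W).

(** The entropy of a variable with [M] values is at most [ln M], by the tangent
line of [ln] at [M]. *)
Lemma entropy_le (M : nat) : (#|[set G y | y : Y]%SET| <= M)%N ->
  avg (fun y => ln (#|Y|%:R / #|[pred y' | G y' == G y]|%:R)) <= ln (M%:R : R).
Proof.
move=> GM; case: (pickP (@predT Y)) => [y0 _|Y0]; last first.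
  rewrite /avg (eq_card0 Y0) invr0 mul0r; case: M {GM} => [|M]; first by rewrite ln0.
  by rewrite ln_ge0// ler1n.
set p := fun w => #|[pred y' | G y' == w]|.
have p0 y : 0 < (p (G y))%:R :> R.
  by rewrite ltr0n; apply/card_gt0P; exists y; rewrite inE.
have Y0 : 0 < #|Y|%:R :> R by exact: card_gt0R y0.
have M0 : 0 < M%:R :> R.
  rewrite ltr0n; apply: leq_trans GM; apply/card_gt0P.
  by exists (G y0); apply: imset_f.
apply: (@le_trans _ _ (avg (fun y => ln (M%:R : R) - 1 +
    #|Y|%:R / M%:R * (p (G y))%:R^-1))).
  apply: ler_avg => y; rewrite -addrA [-1 + _]addrC.
  rewrite [_ / M%:R * _]mulrAC; apply: ln_le_tangent => //.
  by rewrite divr_gt0//; exact: p0.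
rewrite avgD avgZ (avg_cst y0) -addrA gerDl addrC subr_le0.
rewrite /avg [_ / M%:R]mulrC -mulrA mulVKf ?gt_eqF//.
rewrite mulrC ler_pdivrMr// mul1r.
rewrite (partition_big G (mem [set G y | y : Y]%SET))/=; last first.
  by move=> y _; apply: imset_f.
rewrite (eq_bigr (fun=> 1)) ?sumr_const ?ler_nat// => w /imsetP[y _ ->].
under eq_bigr => y' /eqP -> do over.
by rewrite sumr_const -[_ *+ _]mulr_natl; apply: mulfV; rewrite gt_eqF//; exact: p0.
Qed.

End entropy.

(** * Monomials in the labels *)

Lemma avg_odd {R : realType} (Y : finType) (flip : Y -> Y) (h : Y -> R) :
  involutive flip -> (forall y, h (flip y) = - h y) -> avg h = 0.
Proof.
move=> fK hf; suff : avg h = - avg h by lra.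
by rewrite -{1}(avg_bij h (inv_bij fK)) -avgN; apply: eq_avg => y /=.
Qed.

Section monomials.
Context {R : realType} (n : nat).
Local Notation labels := {ffun 'I_n -> bool}.
Implicit Types (I : {set 'I_n}) (y : labels).

Definition bool_sign (b : bool) : R := if b then 1 else -1.

Lemma bool_sign_sqr b : bool_sign b ^+ 2 = 1.
Proof. by case: b; rewrite /bool_sign ?sqrrN expr1n. Qed.

Lemma bool_signN b : bool_sign (~~ b) = - bool_sign b.
Proof. by case: b; rewrite /bool_sign ?opprK. Qed.

Definition mon I y : R := \prod_(i in I) bool_sign (y i).

Definition flip_label (k : 'I_n) y : labels :=
  [ffun i => if i == k then ~~ y i else y i].

Lemma flip_labelK k : involutive (flip_label k).
Proof.
by move=> y; apply/ffunP => i; rewrite !ffunE; case: eqP => // _; rewrite negbK.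
Qed.

Lemma mon_flip k I y : mon I (flip_label k y) = if k \in I then - mon I y else mon I y.
Proof.
have nk (J : {set 'I_n}) : k \notin J -> \prod_(i in J) bool_sign (flip_label k y i) = mon J y.
  move=> kJ; apply: eq_bigr => i iJ; rewrite ffunE; case: eqP => // ik.
  by rewrite -ik iJ in kJ.
case: ifPn => [kI|]; last exact: nk.
rewrite /mon (big_setD1 k)//= [in RHS](big_setD1 k)//= nk ?setD11//.
by rewrite ffunE eqxx bool_signN mulNr.
Qed.

Lemma mon_sqr I y : mon I y * mon I y = 1.
Proof.
by rewrite -expr2 -prodrXl; apply: big1 => i _; exact: bool_sign_sqr.
Qed.

Lemma norm_mon I y : `|mon I y| = 1.
Proof.
apply/eqP; rewrite -(@pexpr_eq1 _ _ 2)//.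
by rewrite real_normK ?num_real// expr2 mon_sqr.
Qed.

Lemma avg_mon2 I I' : avg (fun y => mon I y * mon I' y) = (I == I')%:R.
Proof.
case: eqVneq => [<-|II'].
  by under eq_avg do rewrite mon_sqr; rewrite (avg_cst [ffun=> true]).
have [k kI] : exists k, (k \in I) != (k \in I').
  apply/existsP; apply: contraNT II' => /existsPn h; apply/eqP/setP => k.
  by have := h k; rewrite negbK => /eqP.
apply: (avg_odd (@flip_labelK k)) => y; rewrite !mon_flip.
by case: (k \in I) kI; case: (k \in I') => //= _; rewrite ?mulNr ?mulrN.
Qed.

End monomials.

Section degree_sums.
Context {R : realType}.

Lemma sum_pow_card (n : nat) (x : R) : \sum_(I : {set 'I_n}) x ^+ #|I| = (1 + x) ^+ n.
Proof.
transitivity (\prod_(i < n) (x + 1)); last first.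
  by rewrite prodr_const card_ord addrC.
rewrite bigA_distr; apply: eq_bigr => I _.
by rewrite -big_mkcond/= prodr_const.
Qed.

(** Put [d = n x <= 1].  For [k >= 3], [x ^ k <= d ^ 3 * (1 / n) ^ k], and the sum
of the [(1 / n) ^ #|I|] is [(1 + 1 / n) ^ n <= e]. *)
Lemma sum_high_degree (n : nat) (x : R) : 0 < x -> n%:R * x <= 1 ->
  \sum_(I : {set 'I_n} | (3 <= #|I|)%N) x ^+ #|I| <= expR 1 * (n%:R * x) ^+ 3.
Proof.
case: n => [|n'] x0 nx.
  rewrite mul0r expr0n mulr0 big_pred0// => I.
  by apply/negbTE; rewrite -ltnNge (leq_ltn_trans (max_card _))// card_ord.
set m := n'.+1; have m0 : 0 < m%:R :> R by rewrite ltr0n.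
set d := m%:R * x; have d0 : 0 < d by rewrite mulr_gt0.
apply: (@le_trans _ _ (\sum_(I : {set 'I_m}) d ^+ 3 * (m%:R^-1) ^+ #|I|)).
  rewrite [leRHS](bigID (fun I : {set 'I_m} => (3 <= #|I|)%N))/=.
  rewrite -[leLHS]addr0; apply: lerD; last first.
    by apply: sumr_ge0 => I _; rewrite mulr_ge0// exprn_ge0// ?invr_ge0// ltW.
  apply: ler_sum => I I3.
  have -> : x = d * m%:R^-1 by rewrite /d mulrAC mulfV ?mul1r// gt_eqF.
  rewrite exprMn ler_wpM2r ?exprn_ge0 ?invr_ge0// -(subnKC I3) exprD.
  by rewrite ler_piMr ?exprn_ge0 ?exprn_ile1 ?(ltW d0).
rewrite -mulr_sumr mulrC ler_wpM2r ?exprn_ge0 ?(ltW d0)//.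
rewrite sum_pow_card.
have -> : expR 1 = expR (m%:R^-1) ^+ m :> R.
  by rewrite -expRM_natl mulfV// gt_eqF.
by rewrite lerXn2r ?nnegrE ?expR_ge0 ?addr_ge0 ?invr_ge0// expR_ge1Dx.
Qed.

End degree_sums.

Section low_sets.
Context {R : realType} (n : nat).
Local Notation labels := {ffun 'I_n -> bool}.

(** Sets of size one or two: a pair with equal components gives a singleton. *)
Definition low_sets : {set {set 'I_n}} :=
  [set [set p.1; p.2]%SET | p : 'I_n * 'I_n]%SET.

Lemma card_low_sets : (#|low_sets| <= n ^ 2)%N.
Proof.
by rewrite (leq_trans (leq_imset_card _ _))// card_prod card_ord.
Qed.

Lemma low_sets_gt0 I : I \in low_sets -> (0 < #|I|)%N.
Proof.
by move=> /imsetP[p _ ->]; apply/card_gt0P; exists p.1; rewrite set21.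
Qed.

Lemma low_setsPn (I : {set 'I_n}) :
  I \notin low_sets -> (0 < #|I|)%N -> (3 <= #|I|)%N.
Proof.
move=> Ilow I0; rewrite ltnNge; apply: contra Ilow => I2; apply/imsetP.
have : (#|I| == 1%N) || (#|I| == 2%N) by move: I0 I2; case: #|I| => [|[|[]]].
case/orP => [/cards1P[i ->]|/cards2P[i [k [_ ->]]]].
  by exists (i, i); rewrite //= finset.setUid.
by exists (i, k).
Qed.

Lemma sum_low_sets_le (g : {set 'I_n} -> R) : (forall I, 0 <= g I) ->
  \sum_(I in low_sets) g I <=
  \sum_(i < n) (g [set i]%SET + \sum_(k < n | k != i) g [set i; k]%SET).
Proof.
move=> g0; have <- : \sum_(p : 'I_n * 'I_n) g [set p.1; p.2]%SET =
    \sum_(i < n) (g [set i]%SET + \sum_(k < n | k != i) g [set i; k]%SET).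
  rewrite -(pair_bigA _ (fun i k => g [set i; k]%SET))/=.
  by apply: eq_bigr => i _; rewrite (bigD1 i)//= finset.setUid.
rewrite [leRHS](partition_big (fun p => [set p.1; p.2]%SET) (mem low_sets))/=; last first.
  by move=> p _; apply: imset_f.
apply: ler_sum => I /imsetP[p _ ->]; rewrite (bigD1 p)//= lerDl.
by apply: sumr_ge0.
Qed.

(** Products reduce to single signs: for fixed [i] the [y i * y k] with [k != i]
are again independent signs.  The level-1 inequality is thus used once for the
singletons and once for each [i], whence the factor [n] in front of
[lam2 ^+ 2]. *)
Lemma level12_inequality (lam2 : R) (A : {pred labels}) (y0 : labels) :
  0 <= lam2 -> y0 \in A ->
  \sum_(I in low_sets) lam2 ^+ #|I| * cond_avg A (mon I) ^+ 2 <=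
  8 * (lam2 + n%:R * lam2 ^+ 2) * ln (#|{: labels}|%:R / #|A|%:R).
Proof.
move=> lam0 Ay0; set l := ln _.
apply: le_trans (sum_low_sets_le _) _ => [I|].
  by apply: mulr_ge0; [exact: exprn_ge0|exact: sqr_ge0].
have lev (s : seq 'I_n) (z : 'I_n -> labels -> R) : uniq s ->
    (forall k l, k \in s -> l \in s -> forall y,
      z l (flip_label k y) = if l == k then - z l y else z l y) ->
    (forall k y, `|z k y| <= 1) ->
    \sum_(k <- s) cond_avg A (z k) ^+ 2 <= 8 * l.
  by move=> us zf z1; exact: (level1_inequality us (@flip_labelK n) zf z1 Ay0).
rewrite big_split/=.
have -> : 8 * (lam2 + n%:R * lam2 ^+ 2) * l =
  lam2 * (8 * l) + \sum_(i < n) lam2 ^+ 2 * (8 * l).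
  by rewrite sumr_const card_ord -[_ *+ n]mulr_natl; ring.
apply: lerD.
  under eq_bigr do rewrite cards1 expr1.
  rewrite -mulr_sumr ler_wpM2l// (lev (index_enum _) (fun i => mon [set i]%SET))//.
  - exact: index_enum_uniq.
  - by move=> k i _ _ y; rewrite mon_flip inE eq_sym.
  - by move=> k y; rewrite norm_mon.
apply: ler_sum => i _.
rewrite (eq_bigr (fun k => lam2 ^+ 2 * cond_avg A (mon [set i; k]%SET) ^+ 2)); last first.
  by move=> k ki; rewrite cards2 eq_sym ki.
rewrite -mulr_sumr ler_wpM2l ?exprn_ge0// -big_filter.
apply: (lev _ (fun k => mon [set i; k]%SET)).
- by rewrite filter_uniq// index_enum_uniq.
- move=> k j; rewrite !mem_filter => /andP[ki _] /andP[ji _] y.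
  by rewrite mon_flip !inE (negbTE ki)/= eq_sym.
- by move=> k y; rewrite norm_mon.
Qed.

End low_sets.

(** * One block of samples *)

Section block.
Context {R : realType} (Theta Phi : finType) (chi : Theta -> Phi -> R) (n : nat).
Hypothesis chi_sqr : forall S g, chi S g ^+ 2 = 1.
Variable Lam : R.
Hypothesis Lam01 : 0 <= Lam <= 1.
Local Notation feats := {ffun 'I_n -> Phi}.
Local Notation labels := {ffun 'I_n -> bool}.

(** Density of the labels [y] under hypothesis [S] with respect to fair coins,
given the features [f]. *)
Definition label_likelihood S (f : feats) (y : labels) : R :=
  \prod_(i < n) (1 + Lam * (bool_sign (y i) * chi S (f i))).

Definition chi_prod S (f : feats) (I : {set 'I_n}) : R := \prod_(i in I) chi S (f i).

Lemma chi_prod_sqr S f I : chi_prod S f I ^+ 2 = 1.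
Proof. by rewrite -prodrXl; apply: big1 => i _; exact: chi_sqr. Qed.

Lemma label_likelihoodE S f y : label_likelihood S f y =
  \sum_(I : {set 'I_n}) Lam ^+ #|I| * chi_prod S f I * mon I y.
Proof.
rewrite /label_likelihood; under eq_bigr do rewrite addrC.
rewrite bigA_distr; apply: eq_bigr => I _; rewrite -big_mkcond/=.
rewrite !big_split/= prodr_const -mulrA; congr (_ * _).
by rewrite mulrC.
Qed.

(** Inner product over the hypotheses of the characters attached to [I] and [I'].
For parities it is 1 if [I = I'] and tiny on average over [f] otherwise, which
makes the monomials of the likelihood nearly orthogonal. *)
Definition feature_overlap f I I' : R :=
  avg (fun S => chi_prod S f I * chi_prod S f I').

Definition low_part S f y : R :=
  \sum_(I in @low_sets n) Lam ^+ #|I| * chi_prod S f I * mon I y.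

Definition high_part S f y : R :=
  \sum_(I : {set 'I_n} | (3 <= #|I|)%N) Lam ^+ #|I| * chi_prod S f I * mon I y.

Lemma low_sets_lt3 I : I \in @low_sets n -> (#|I| < 3)%N.
Proof. by move=> /imsetP[p _ ->]; rewrite cards2; case: (_ != _). Qed.

Lemma label_likelihood_split S f y :
  label_likelihood S f y = 1 + low_part S f y + high_part S f y.
Proof.
rewrite label_likelihoodE (bigD1 finset.set0)//= cards0 expr0 mul1r.
rewrite /chi_prod /mon !big_set0 mulr1 -addrA; congr (_ + _).
rewrite (bigID (mem (@low_sets n)))/=; congr (_ + _); apply: eq_bigl => I.
  apply/andP/idP => [[]//|Il]; split => //.
  by rewrite -card_gt0 low_sets_gt0.
apply/andP/idP => [[I0 Il]|I3].
  by rewrite (low_setsPn Il)// card_gt0.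
split; first by rewrite -card_gt0 (leq_trans _ I3).
by apply/negP => /low_sets_lt3; rewrite ltnNge I3.
Qed.

Lemma avg_high_part_sqr S f : 0 < Lam -> n%:R * Lam ^+ 2 <= 1 ->
  avg (fun y => high_part S f y ^+ 2) <= expR 1 * (n%:R * Lam ^+ 2) ^+ 3.
Proof.
move=> Lam0 nL; apply: le_trans (sum_high_degree _ nL); last by rewrite exprn_gt0.
rewrite le_eqVlt; apply/orP; left; apply/eqP.
under eq_avg do rewrite expr2 /high_part mulr_suml.
rewrite avg_sum; apply: eq_bigr => I I3.
under eq_avg do rewrite mulr_sumr.
rewrite avg_sum (bigD1 I)//= big1 ?addr0; last first.
  move=> J /andP[_ JI].
  transitivity (Lam ^+ #|I| * chi_prod S f I * (Lam ^+ #|J| * chi_prod S f J) *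
     avg (fun y => mon I y * mon J y)).
    by rewrite -avgZ; apply: eq_avg => y; ring.
  by rewrite avg_mon2 eq_sym (negbTE JI) mulr0.
transitivity (Lam ^+ #|I| * chi_prod S f I * (Lam ^+ #|I| * chi_prod S f I) *
     avg (fun y => mon I y * mon I y)).
  by rewrite -avgZ; apply: eq_avg => y; ring.
rewrite avg_mon2 eqxx mulr1 -exprM mulnC exprM.
by rewrite mulrACA -!expr2 chi_prod_sqr mulr1.
Qed.

Section fixed_features.
Variables (W : finType) (G : labels -> W) (f : feats) (M : nat).
Hypothesis GM : (#|[set G y | y : labels]%SET| <= M)%N.
Hypothesis overlap_ge0 : forall I I', 0 <= feature_overlap f I I'.

Local Notation fiber y := [pred y' | G y' == G y].

(** On average over [S] the square of the conditional average of [low_part] is a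
double sum over [I] and [I'].  The diagonal is what the message reveals and is
bounded by [level12_inequality] and [entropy_le]; off the diagonal the
coefficients are bounded by 1. *)
Lemma avg_low_part_sqr :
  avg (fun y => avg (fun S => cond_avg (fiber y) (low_part S f) ^+ 2)) <=
  8 * (Lam ^+ 2 + n%:R * Lam ^+ 4) * ln M%:R +
  \sum_(I in @low_sets n) \sum_(I' in @low_sets n | I' != I) feature_overlap f I I'.
Proof.
set E := \sum_(I in _) _.
pose e y I := cond_avg (fiber y) (mon I) : R.
have e1 y I : `|e y I| <= 1 by apply: cond_avg_abs_le1 => y'; rewrite norm_mon.
have expand y : avg (fun S => cond_avg (fiber y) (low_part S f) ^+ 2) =
    \sum_(I in @low_sets n) \sum_(I' in @low_sets n)
      (Lam ^+ #|I| * e y I) * (Lam ^+ #|I'| * e y I') * feature_overlap f I I'.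
  have c S : cond_avg (fiber y) (low_part S f) =
      \sum_(I in @low_sets n) Lam ^+ #|I| * e y I * chi_prod S f I.
    rewrite /low_part cond_avg_sum; apply: eq_bigr => I _.
    by rewrite cond_avgZ mulrAC.
  under eq_avg do rewrite c expr2 mulr_suml.
  rewrite avg_sum; apply: eq_bigr => I _.
  under eq_avg do rewrite mulr_sumr.
  rewrite avg_sum; apply: eq_bigr => I' _.
  by rewrite -avgZ; apply: eq_avg => S; ring.
have bound y : avg (fun S => cond_avg (fiber y) (low_part S f) ^+ 2) <=
    8 * (Lam ^+ 2 + n%:R * Lam ^+ 4) * ln (#|{: labels}|%:R / #|fiber y|%:R) + E.
  have yf : y \in fiber y by rewrite inE.
  have := level12_inequality (sqr_ge0 Lam) yf; rewrite -exprM => h.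
  rewrite expand; apply: le_trans (lerD h (lexx E)).
  rewrite /E -big_split/=; apply: ler_sum => I Il.
  rewrite (bigD1 I)//=; apply: lerD.
    have ov1 : feature_overlap f I I <= 1.
      by apply: avg_le_cst => // S; rewrite -expr2 chi_prod_sqr.
    apply: le_trans (ler_wpM2l _ ov1) _; first by rewrite -expr2 sqr_ge0.
    by rewrite mulr1 -exprM mulnC exprM -exprMn expr2.
  apply: ler_sum => I' _; rewrite -[leRHS]mul1r; apply: ler_wpM2r => //.
  apply: le_trans (ler_norm _) _; rewrite normrM.
  have L1 (J : {set 'I_n}) : `|Lam ^+ #|J| * e y J| <= 1.
    rewrite normrM mulr_ile1// normrX; case/andP: Lam01 => L0 L1.
    by rewrite exprn_ile1// ger0_norm.
  by rewrite mulr_ile1// L1.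
apply: le_trans (ler_avg bound) _; rewrite avgD (avg_cst [ffun=> true]) lerD2r.
rewrite avgZ; apply: ler_wpM2l; last exact: entropy_le.
by rewrite mulr_ge0// addr_ge0 ?mulr_ge0 ?exprn_ge0 ?sqr_ge0//; case/andP: Lam01.
Qed.

(** Among functions [c] of the message, the average of [2 * (1 - l) * c - c ^+ 2]
is largest when [c] is the conditional average of [1 - l], where it is the mean
square of that conditional average.  The bound over all [c] is therefore a
bound on this mean square, but one that is linear in the law of the block. *)
Lemma avg_label_deviation_fixed (c : Theta -> W -> R) :
  0 < Lam -> n%:R * Lam ^+ 2 <= 1 ->
  avg (fun S => avg (fun y =>
    2 * (1 - label_likelihood S f y) * c S (G y) - c S (G y) ^+ 2)) <=
  2 * (8 * (Lam ^+ 2 + n%:R * Lam ^+ 4) * ln M%:R +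
   \sum_(I in @low_sets n) \sum_(I' in @low_sets n | I' != I) feature_overlap f I I')
  + 2 * (expR 1 * (n%:R * Lam ^+ 2) ^+ 3).
Proof.
move=> Lam0 nL.
apply: (@le_trans _ _ (avg (fun S =>
  avg (fun y => 2 * cond_avg (fiber y) (low_part S f) ^+ 2) +
  avg (fun y => 2 * high_part S f y ^+ 2)))).
  apply: ler_avg => S.
  (* [- 2 * a * c <= 2 * a ^+ 2 + c ^+ 2 / 2], once for each part [a]. *)
  apply: (@le_trans _ _ (avg (fun y => - 2 * (low_part S f y * c S (G y)) +
     (- 2^-1 * c S (G y) ^+ 2 + 2 * high_part S f y ^+ 2)))).
    apply: ler_avg => y; rewrite label_likelihood_split.
    have := sqr_ge0 (2 * high_part S f y + c S (G y)); lra.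
  rewrite avgD [avg (fun x => - 2 * _)]avgZ -(avg_fiber G (low_part S f) (c S)) -avgZ -avgD -avgD.
  apply: ler_avg => y.
  have := sqr_ge0 (2 * cond_avg (fiber y) (low_part S f) + c S (G y)); lra.
rewrite avgD; apply: lerD.
  rewrite avg_exchange; under eq_avg do rewrite avgZ.
  by rewrite avgZ ler_wpM2l// avg_low_part_sqr.
apply: avg_le_cst => [|S].
  apply: mulr_ge0 => //; apply: mulr_ge0; first exact: expR_ge0.
  by apply: exprn_ge0; rewrite mulr_ge0 // sqr_ge0.
by rewrite avgZ ler_wpM2l// avg_high_part_sqr.
Qed.

End fixed_features.

Lemma avg_label_deviation (W : finType) (G : feats -> labels -> W) (M : nat)
    (delta : R) (g0 : Phi) (c : Theta -> W -> R) :
  (forall f, (#|[set G f y | y : labels]%SET| <= M)%N) ->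
  (forall f I I', 0 <= feature_overlap f I I') ->
  (forall I I', I != I' -> avg (fun f => feature_overlap f I I') <= delta) ->
  0 <= delta -> 0 < Lam -> n%:R * Lam ^+ 2 <= 1 ->
  avg (fun S => avg (fun f => avg (fun y =>
    2 * (1 - label_likelihood S f y) * c S (G f y) - c S (G f y) ^+ 2))) <=
  2 * (8 * (Lam ^+ 2 + n%:R * Lam ^+ 4) * ln M%:R + (n ^ 4)%:R * delta)
  + 2 * (expR 1 * (n%:R * Lam ^+ 2) ^+ 3).
Proof.
move=> GM ov0 ovd d0 Lam0 nL; rewrite avg_exchange.
have h f := avg_label_deviation_fixed (GM f) (ov0 f) c Lam0 nL.
apply: le_trans (ler_avg h) _; rewrite avgD (avg_cst [ffun=> g0]) lerD2r.
rewrite avgZ ler_wpM2l// avgD (avg_cst [ffun=> g0]) lerD2l avg_sum.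
apply: (@le_trans _ _ (\sum_(I in @low_sets n) \sum_(I' in @low_sets n) delta)).
  apply: ler_sum => I Il; rewrite avg_sum.
  rewrite [leRHS](bigD1 I)//= -[leLHS]add0r lerD// ler_sum// => I' /andP[_ II'].
  by rewrite ovd// eq_sym.
rewrite !sumr_const -mulrnA -[leLHS]mulr_natl ler_wpM2r// ler_nat.
have -> : (n ^ 4 = n ^ 2 * n ^ 2)%N by rewrite -expnD.
by apply: leq_mul; exact: card_low_sets.
Qed.

End block.

(** * Relative entropy of a transcript splits over the blocks *)

Section kl_function.
Context {R : realType}.
Implicit Types L : R.

(** If [L] is the likelihood ratio of Q with respect to P, the average of [klfun L]
under P is the relative entropy from P to Q. *)
Definition klfun L : R := L - 1 - ln L.

Lemma klfun_ge0 L : 0 < L -> 0 <= klfun L.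
Proof.
by move=> L0; have := ln_le_tangent (@ltr01 R) L0; rewrite /klfun ln1 divr1; lra.
Qed.

(** The step from relative entropy to total variation, as in Pinsker's inequality:
[klfun L >= (1 - r) ^+ 2] for [r = sqrt L], and [1 - L <= 2 * (1 - r)]. *)
Lemma deficit_le_klfun L (eps : R) : 0 < L -> 0 < eps ->
  Num.max (1 - L) 0 <= eps + klfun L / eps.
Proof.
move=> L0 e0; rewrite ge_max; apply/andP; split; last first.
  by rewrite addr_ge0 ?divr_ge0 ?klfun_ge0 ?ltW.
case: (leP L 1) => L1; last first.
  apply: (@le_trans _ _ 0); first lra.
  by rewrite addr_ge0 ?divr_ge0 ?klfun_ge0 ?ltW.
have [r [r0 r1 Lr]] : exists r, [/\ 0 < r, r <= 1 & L = r ^+ 2].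
  exists (Num.sqrt L); rewrite sqrtr_gt0 L0 sqr_sqrtr ?(ltW L0)//; split => //.
  by rewrite -sqrtr1 ler_wsqrtr.
have k : (1 - r) ^+ 2 <= klfun L.
  have := ln_le_tangent (@ltr01 R) r0.
  by rewrite /klfun Lr lnXn// ln1 divr1; lra.
rewrite -(ler_pM2r e0) [leRHS]mulrDl divfK ?gt_eqF//.
move: k; rewrite Lr => k; have := sqr_ge0 (eps - (1 - r)); have := mulr_ge0 (ltW e0) (sqr_ge0 (1 - r)).
nra.
Qed.

(** Quadratic near 1.  Below 1/2 the logarithm is absorbed by a negative power:
negative powers are convex, so that their averages do not grow under
conditioning. *)
Lemma klfun_le L q : 0 < L -> (0 < q)%N ->
  klfun L <= 2 * (1 - L) ^+ 2 + 2 * 2^-1 ^+ q * L^-1 ^+ q.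
Proof.
move=> L0 q0; case: (leP 2^-1 L) => L2.
  have := @ln1D_ge R (L - 1); rewrite subrKC /klfun => h.
  apply: (@le_trans _ _ (2 * (1 - L) ^+ 2)).
    have := h _; rewrite (_ : - 2^-1 <= L - 1); last lra.
    by move=> /(_ isT); lra.
  by rewrite lerDl !mulr_ge0// exprn_ge0// invr_ge0 ltW.
apply: (@le_trans _ _ (2 * 2^-1 ^+ q * L^-1 ^+ q)); last first.
  by rewrite lerDr mulr_ge0// sqr_ge0.
rewrite -mulrA -exprMn; set t := 2^-1 * L^-1.
have t1 : 1 <= t by rewrite /t -invfM invf_ge1 ?mulr_gt0//; lra.
apply: (@le_trans _ _ (2 * t)); last first.
  by rewrite ler_wpM2l// ler_eXnr.
have Li : 0 < L^-1 by rewrite invr_gt0.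
have := ln_le_tangent (@ltr01 R) Li; rewrite ln1 divr1 lnV ?posrE// /klfun.
by rewrite /t; lra.
Qed.

(** The tangent line at [m] of the convex function [x ^- q]. *)
Lemma inv_pow_tangent (q : nat) (m x : R) : 0 < m -> 0 < x ->
  m^-1 ^+ q * (1 + q%:R * (1 - m^-1 * x)) <= x^-1 ^+ q.
Proof.
move=> m0 x0; set t := m / x; have t0 : 0 < t by rewrite divr_gt0.
have -> : x^-1 = m^-1 * t by rewrite /t mulrA mulVf ?mul1r// gt_eqF.
rewrite exprMn ler_wpM2l ?exprn_ge0 ?invr_ge0 ?(ltW m0)//.
have -> : m^-1 * x = t^-1 by rewrite /t invf_div mulrC.
have ht : 1 - t^-1 <= t - 1.
  rewrite -subr_ge0 (_ : _ - _ = t^-1 * (t - 1) ^+ 2); last by field; rewrite gt_eqF.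
  by rewrite mulr_ge0 ?sqr_ge0// invr_ge0 ltW.
apply: (@le_trans _ _ (1 + q%:R * (t - 1))).
  by rewrite lerD2l ler_wpM2l.
elim: q => [|q IH]; first by rewrite mul0r addr0 expr0.
rewrite exprS; apply: (@le_trans _ _ (t * (1 + q%:R * (t - 1)))); last first.
  by apply: ler_wpM2l => //; exact: ltW.
rewrite -natr1; have := mulr_ge0 (ler0n R q) (sqr_ge0 (t - 1)); nra.
Qed.

Lemma cond_avg_inv_pow (T : finType) (A : {pred T}) (x0 : T) (f : T -> R) q : x0 \in A ->
  (forall x, 0 < f x) -> (cond_avg A f)^-1 ^+ q <= cond_avg A (fun x => (f x)^-1 ^+ q).
Proof.
move=> Ax0 f0; set m := cond_avg A f.
have m0 : 0 < m.
  rewrite mulr_gt0 ?invr_gt0 ?ltr0n//; first by apply/card_gt0P; exists x0.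
  by rewrite (bigD1 x0)//= ltr_pwDl// sumr_ge0// => x _; exact: ltW.
apply: le_trans (ler_cond_avg (fun x _ => inv_pow_tangent q m0 (f0 x))).
rewrite cond_avgZ.
under [X in cond_avg A X]eq_fun do rewrite mulrBr mulr1 addrA -mulrN.
rewrite cond_avgD cond_avgZ (cond_avg_cst _ Ax0).
under [X in cond_avg A X]eq_fun do rewrite -mulNr.
by rewrite cond_avgZ -/m mulNr mulVf ?gt_eqF// mulrN1 addrK mulr1.
Qed.

End kl_function.

Section transcripts.
Context {R : realType} (J B W : finType).
Variables (rect : J -> W -> pred B) (tr : {ffun J -> B} -> W).
Hypothesis trP : forall x w, (tr x == w) = [forall j, rect j w (x j)].
Variable ell : B -> R.
Hypotheses (ell_gt0 : forall b, 0 < ell b) (avg_ell : avg ell = 1).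

(** Given the transcript the blocks stay independent, because they range over a
product set. *)
Lemma cond_avg_fiber_prod (h : J -> B -> R) w :
  cond_avg [pred x | tr x == w] (fun x => \prod_j h j (x j)) =
  \prod_j cond_avg (rect j w) (h j).
Proof.
have sum_fiber (g : J -> B -> R) : \sum_(x in [pred x | tr x == w]) \prod_j g j (x j) =
    \prod_j \sum_(b in rect j w) g j b.
  rewrite bigA_distr_big_dep; apply: eq_bigl => x.
  by rewrite inE trP; apply/forallP/familyP => h' j; have := h' j.
have card_fiber : #|[pred x | tr x == w]|%:R = \prod_j #|rect j w|%:R :> R.
  transitivity (\sum_(x in [pred x | tr x == w]) \prod_(j : J) (1 : R)).
    by rewrite [\prod_j _]big1_eq sumr_const.
  rewrite (sum_fiber (fun _ _ => 1)); apply: eq_bigr => j _.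
  by rewrite sumr_const.
by rewrite /cond_avg sum_fiber card_fiber -prodfV -big_split.
Qed.

Lemma cond_avg_fiber_coord (h : B -> R) j x :
  cond_avg [pred x' | tr x' == tr x] (fun x' => h (x' j)) = cond_avg (rect j (tr x)) h.
Proof.
have xr k : x k \in rect k (tr x).
  by have := trP x (tr x); rewrite eqxx => /esym/forallP/(_ k).
transitivity (cond_avg [pred x' | tr x' == tr x]
    (fun x' => \prod_k (if k == j then h (x' k) else 1))).
  by rewrite /cond_avg; under [in RHS]eq_bigr do rewrite -big_mkcond/= big_pred1_eq.
rewrite (cond_avg_fiber_prod (fun k b => if k == j then h b else 1)).
rewrite (bigD1 j)//= eqxx big1 ?mulr1// => k /negbTE ->.
exact: (cond_avg_cst _ (xr k)).
Qed.

Lemma avg_coord (h : B -> R) j : avg (fun x : {ffun J -> B} => h (x j)) = avg h.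
Proof.
case: (pickP (@predT B)) => [b0 _|B0]; last first.
  rewrite /avg (eq_card0 B0) card_ffun (eq_card0 B0) invr0 exp0n ?invr0 ?mul0r//.
  by apply/card_gt0P; exists j.
transitivity (avg (fun x : {ffun J -> B} => \prod_k (if k == j then h (x k) else 1))).
  by apply: eq_avg => x; rewrite -big_mkcond/= big_pred1_eq.
rewrite (avg_prod (fun k b => if k == j then h b else 1)).
rewrite (bigD1 j)//= eqxx big1 ?mulr1// => k /negbTE ->.
exact: (avg_cst b0).
Qed.

(** Likelihood ratio of the transcript [w] when only block [j] is drawn from the
alternative. *)
Definition cond_likelihood j w : R := cond_avg (rect j w) ell.

Lemma avg_cond_likelihood j (c : W -> R) :
  avg (fun x => cond_likelihood j (tr x) * c (tr x)) = avg (fun x : {ffun J -> B} => ell (x j) * c (tr x)).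
Proof.
rewrite -(avg_fiber tr (fun x : {ffun J -> B} => ell (x j)) c); apply: eq_avg => x.
by rewrite cond_avg_fiber_coord.
Qed.

Lemma avg_cond_likelihood_prod (c : W -> R) :
  avg (fun x => (\prod_j cond_likelihood j (tr x)) * c (tr x)) =
  avg (fun x : {ffun J -> B} => (\prod_j ell (x j)) * c (tr x)).
Proof.
rewrite -(avg_fiber tr (fun x : {ffun J -> B} => \prod_j ell (x j)) c); apply: eq_avg => x.
by rewrite (cond_avg_fiber_prod (fun=> ell)).
Qed.

Lemma rect_tr j (x : {ffun J -> B}) : x j \in rect j (tr x).
Proof. by have := trP x (tr x); rewrite eqxx => /esym/forallP/(_ j). Qed.

Lemma cond_likelihood_gt0 j (x : {ffun J -> B}) : 0 < cond_likelihood j (tr x).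
Proof.
have xr := rect_tr j x; rewrite /cond_likelihood /cond_avg mulr_gt0 ?invr_gt0 ?ltr0n//.
  by apply/card_gt0P; exists (x j).
by rewrite (bigD1 (x j))//= ltr_pwDl// sumr_ge0// => b _; exact: ltW.
Qed.

Lemma avg_cond_likelihood_inv_pow j q :
  avg (fun x => (cond_likelihood j (tr x))^-1 ^+ q) <= avg (fun b => (ell b)^-1 ^+ q).
Proof.
apply: (@le_trans _ _ (avg (fun x =>
    cond_avg [pred x' | tr x' == tr x] (fun x' : {ffun J -> B} => (ell (x' j))^-1 ^+ q) * 1))).
  apply: ler_avg => x; rewrite mulr1 (cond_avg_fiber_coord (fun b => (ell b)^-1 ^+ q)).
  by apply: cond_avg_inv_pow => //; exact: rect_tr.
rewrite (avg_fiber tr (fun x' : {ffun J -> B} => (ell (x' j))^-1 ^+ q) (fun=> 1)).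
under eq_avg do rewrite mulr1.
by rewrite (avg_coord (fun b => (ell b)^-1 ^+ q)).
Qed.

Lemma avg_ell_prod (x0 : {ffun J -> B}) :
  avg (fun x : {ffun J -> B} => \prod_j ell (x j)) = 1.
Proof. by rewrite (avg_prod (fun=> ell)) big1. Qed.

(** Since the likelihood ratio of a transcript is the product of the conditional
likelihoods of its blocks, its relative entropy is the sum over [j] of the
averages of [klfun (cond_likelihood j)].  The square of
[1 - cond_likelihood j] is left in the variational form
[2 * (1 - ell) * c - c ^+ 2], so that it can be bounded for one block at a
time, the others being fixed. *)
Lemma likelihood_event_le (E : pred W) (eps : R) (q : nat) (x0 : {ffun J -> B}) :
  0 < eps -> (0 < q)%N ->
  avg (fun x : {ffun J -> B} => (\prod_j ell (x j)) * (E (tr x))%:R) <=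
  avg (fun x => (E (tr x))%:R) + eps + eps^-1 * \sum_j
    (2 * avg (fun x : {ffun J -> B} => 2 * (1 - ell (x j)) * (1 - cond_likelihood j (tr x)) - (1 - cond_likelihood j (tr x)) ^+ 2)
     + 2 * 2^-1 ^+ q * avg (fun b => (ell b)^-1 ^+ q)).
Proof.
move=> e0 q0; rewrite -(avg_cond_likelihood_prod (fun w => (E w)%:R)).
pose L x := \prod_j cond_likelihood j (tr x).
have L0 x : 0 < L x by apply: prodr_gt0 => j _; exact: cond_likelihood_gt0.
have avgL : avg L = 1.
  rewrite -[RHS](avg_ell_prod x0); transitivity (avg (fun x => L x * 1)).
    by apply: eq_avg => x; rewrite mulr1.
  by rewrite (avg_cond_likelihood_prod (fun=> 1)); apply: eq_avg => x; rewrite mulr1.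
have avg_post1 j : avg (fun x => cond_likelihood j (tr x)) = 1.
  transitivity (avg (fun x => cond_likelihood j (tr x) * 1)).
    by apply: eq_avg => x; rewrite mulr1.
  rewrite (avg_cond_likelihood j (fun=> 1)) -[RHS]avg_ell -(avg_coord _ j).
  by apply: eq_avg => x; rewrite mulr1.
apply: (@le_trans _ _ (avg (fun x => (E (tr x))%:R + eps + (L x - 1) +
    eps^-1 * klfun (L x)))).
  apply: ler_avg => x; rewrite -/(L x).
  have := deficit_le_klfun (L0 x) e0; rewrite ge_max [_ / eps]mulrC => /andP[h1 h2].
  by case: (E _) => /=; lra.
have kl : avg (fun x => klfun (L x)) = \sum_j avg (fun x => klfun (cond_likelihood j (tr x))).
  transitivity (avg (fun x => (L x - 1) +
     \sum_j (klfun (cond_likelihood j (tr x)) - (cond_likelihood j (tr x) - 1)))).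
    apply: eq_avg => x; rewrite /klfun ln_prod; last by move=> j; exact: cond_likelihood_gt0.
    by congr (_ + _); rewrite -sumrN; apply: eq_bigr => j _; ring.
  rewrite avgD avgB avgL (avg_cst x0) subrr add0r avg_sum; apply: eq_bigr => j _.
  by rewrite avgB [X in _ - X]avgB avg_post1 (avg_cst x0) subrr subr0.
rewrite avgD avgZ kl avgD avgB avgL (avg_cst x0) subrr addr0.
rewrite avgD (avg_cst x0) lerD2l ler_pM2l ?invr_gt0//; apply: ler_sum => j _.
apply: (@le_trans _ _ (avg (fun x => 2 * (1 - cond_likelihood j (tr x)) ^+ 2 +
    2 * 2^-1 ^+ q * (cond_likelihood j (tr x))^-1 ^+ q))).
  by apply: ler_avg => x; apply: klfun_le => //; exact: cond_likelihood_gt0.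
rewrite avgD avgZ avgZ; apply: lerD; last first.
  by rewrite ler_wpM2l ?mulr_ge0 ?exprn_ge0// avg_cond_likelihood_inv_pow.
rewrite ler_wpM2l// -subr_ge0 -avgB; rewrite le_eqVlt; apply/orP; left; apply/eqP.
transitivity (avg (fun x => 2 * (cond_likelihood j (tr x) * (1 - cond_likelihood j (tr x)) -
    ell (x j) * (1 - cond_likelihood j (tr x))))).
  by rewrite avgZ avgB (avg_cond_likelihood j (fun w => 1 - cond_likelihood j w)) subrr mulr0.
by apply: eq_avg => x; ring.
Qed.

End transcripts.

Section resample.
Context {R : realType} (J B : finType).

Definition set_coord (x : {ffun J -> B}) j b : {ffun J -> B} :=
  [ffun k => if k == j then b else x k].

(** The map from [(x, b)] to [(set_coord x j b, x j)] is an involution. *)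
Lemma avg_resample (G : {ffun J -> B} -> R) j (b0 : B) :
  avg G = avg (fun x => avg (fun b => G (set_coord x j b))).
Proof.
transitivity (avg (fun p : {ffun J -> B} * B => G p.1)).
  by rewrite avg_pair; apply: eq_avg => x /=; rewrite (avg_cst b0).
pose sw (p : {ffun J -> B} * B) := (set_coord p.1 j p.2, p.1 j).
have swK : involutive sw.
  move=> [x b]; rewrite /sw/= ffunE eqxx; congr (_, _); apply/ffunP => k.
  by rewrite !ffunE; case: eqP => // ->.
by rewrite -(avg_bij _ (inv_bij swK)) avg_pair.
Qed.

End resample.

(** * Parities of sign patterns *)

Section parity.
Context {R : realType} (D : nat).
Local Notation subsets := {set 'I_D}.

(** The sign pattern is given by the set [g] of its negative coordinates. *)
Definition parity (S g : subsets) : R := \prod_(j in S) bool_sign (j \notin g).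

Lemma parity_sqr S g : parity S g ^+ 2 = 1.
Proof. by rewrite -prodrXl; apply: big1 => j _; exact: bool_sign_sqr. Qed.

Lemma norm_parity S g : `|parity S g| = 1.
Proof.
by apply/eqP; rewrite -(@pexpr_eq1 _ _ 2)// real_normK ?num_real// parity_sqr.
Qed.

Definition toggle (j : 'I_D) (g : subsets) : subsets :=
  [set i | if i == j then i \notin g else i \in g]%SET.

Lemma toggleK j : involutive (toggle j).
Proof.
by move=> g; apply/setP => i; rewrite !inE; case: eqP => // ->; rewrite negbK.
Qed.

Lemma parity_toggle (S : subsets) j g : j \in S -> parity S (toggle j g) = - parity S g.
Proof.
move=> jS; rewrite /parity (big_setD1 j)//= [in RHS](big_setD1 j)//=.
rewrite inE eqxx -mulNr -bool_signN; congr (_ * _); apply: eq_bigr => i.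
by rewrite !inE => /andP[/negbTE ->].
Qed.

Lemma card_subsets : #|{: subsets}| = (2 ^ D)%N.
Proof. by rewrite -cardsT -powersetT card_powerset cardsT card_ord. Qed.

Section overlap.
Variable n : nat.
Local Notation feats := {ffun 'I_n -> subsets}.
Implicit Types (I : {set 'I_n}) (f : feats).

(** The average over [S] of the product of signs [e j] over [j] in [S] is, up to
scaling, the product over all [j] of [1 + e j]. *)
Lemma parity_overlap_ge0 f I I' : 0 <= feature_overlap parity f I I'.
Proof.
pose e j : R := (\prod_(i in I) bool_sign (j \notin f i)) * \prod_(i in I') bool_sign (j \notin f i).
have -> : feature_overlap parity f I I' = #|{: subsets}|%:R^-1 * \prod_(j < D) (e j + 1).
  rewrite /feature_overlap /avg; congr (_ * _).
  rewrite bigA_distr; apply: eq_bigr => S _; rewrite -big_mkcond/=.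
  by rewrite big_split/= /chi_prod /parity; congr (_ * _); rewrite exchange_big.
rewrite mulr_ge0 ?invr_ge0// prodr_ge0// => j _.
have : `|e j| <= 1.
  rewrite normrM !normr_prod !big1 ?mulr1// => i _;
  by rewrite /bool_sign; case: ifP; rewrite ?normrN normr1.
by rewrite ler_norml => /andP[+ _]; lra.
Qed.

(** If [j] is in [S] and [k] is in exactly one of [I] and [I'], toggling coordinate
[j] of the feature vector [f k] reverses the product of the two characters.
Only the empty [S] contributes to the average. *)
Lemma avg_parity_overlap I I' : I != I' ->
  avg (fun f => feature_overlap parity f I I') <= 2^-1 ^+ D.
Proof.
move=> II'; rewrite /feature_overlap avg_exchange.
have [k kI] : exists k, (k \in I) != (k \in I').
  apply/existsP; apply: contraNT II' => /existsPn h; apply/eqP/setP => k.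
  by have := h k; rewrite negbK => /eqP.
have zero (S : subsets) : S != finset.set0 ->
    avg (fun f => chi_prod parity S f I * chi_prod parity S f I') = 0.
  case/set0Pn => j jS.
  pose fl (f : feats) : feats := [ffun i => if i == k then toggle j (f i) else f i].
  have flK : involutive fl.
    by move=> f; apply/ffunP => i; rewrite !ffunE; case: eqP => // _; rewrite toggleK.
  have chi_fl (J : {set 'I_n}) f : chi_prod parity S (fl f) J =
      if k \in J then - chi_prod parity S f J else chi_prod parity S f J.
    have nk (J' : {set 'I_n}) : k \notin J' ->
        \prod_(i in J') parity S (fl f i) = chi_prod parity S f J'.
      move=> kJ; apply: eq_bigr => i iJ; rewrite ffunE; case: eqP => // ik.
      by rewrite -ik iJ in kJ.
    case: ifPn => [kJ|]; last exact: nk.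
    rewrite /chi_prod (big_setD1 k)//= [in RHS](big_setD1 k)//= nk ?setD11//.
    by rewrite ffunE eqxx parity_toggle// mulNr.
  apply: (avg_odd flK) => f; rewrite !chi_fl.
  by case: (k \in I) kI; case: (k \in I') => //= _; rewrite ?mulNr ?mulrN.
rewrite {1}/avg (bigD1 finset.set0)//= big1 ?addr0; last by move=> S; exact: zero.
rewrite card_subsets natrX -exprVn ler_piMr ?exprn_ge0 ?invr_ge0//.
apply: avg_le_cst => // f.
by rewrite /chi_prod /parity !big1 ?mulr1// => i _; rewrite big_set0.
Qed.

End overlap.

Section sample_block.
Variables (n : nat) (Lam : R).
Hypothesis Lam01 : 0 <= Lam < 1.
Local Notation sample := (subsets * bool)%type.

Definition sample_likelihood S (u : sample) : R := 1 + Lam * (bool_sign u.2 * parity S u.1).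

Definition block_likelihood S (b : {ffun 'I_n -> sample}) : R :=
  \prod_i sample_likelihood S (b i).

Lemma norm_label_parity S (u : sample) : `|bool_sign u.2 * parity S u.1| = 1.
Proof.
by rewrite normrM norm_parity mulr1 /bool_sign; case: ifP; rewrite ?normrN normr1.
Qed.

Lemma sample_likelihood_gt0 S u : 0 < sample_likelihood S u.
Proof.
rewrite /sample_likelihood; set a := _ * parity _ _.
have : `|Lam * a| < 1.
  by rewrite normrM norm_label_parity mulr1 ger0_norm; case/andP: Lam01.
by rewrite ltr_norml => /andP[+ _]; lra.
Qed.

Lemma block_likelihood_gt0 S b : 0 < block_likelihood S b.
Proof. by apply: prodr_gt0 => i _; exact: sample_likelihood_gt0. Qed.

Lemma avg_bool (h : bool -> R) : avg h = (h true + h false) / 2.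
Proof. by rewrite /avg card_bool big_bool mulrC. Qed.

Lemma avg_sample_likelihood S : avg (sample_likelihood S) = 1.
Proof.
rewrite avg_pair (eq_avg (g := fun=> 1)); first exact: (avg_cst finset.set0).
by move=> g; rewrite avg_bool /sample_likelihood /bool_sign/=; lra.
Qed.

Lemma avg_block_likelihood S : avg (block_likelihood S) = 1.
Proof.
rewrite (avg_prod (fun=> sample_likelihood S)) big1// => i _.
exact: avg_sample_likelihood.
Qed.

(** By Bernoulli's inequality, one sample contributes at most the mean of
[(1 + t)^-1] and [(1 - t)^-1], where [t = q * Lam]. *)
Lemma avg_block_likelihood_inv_pow S q : q%:R * Lam <= 2^-1 ->
  avg (fun b => (block_likelihood S b)^-1 ^+ q) <= expR (2 * (q%:R * Lam) ^+ 2 * n%:R).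
Proof.
move=> qL; case/andP: Lam01 => L0 L1.
have -> : avg (fun b => (block_likelihood S b)^-1 ^+ q) =
    \prod_(i < n) avg (fun u => (sample_likelihood S u)^-1 ^+ q).
  rewrite -(avg_prod (fun _ u => (sample_likelihood S u)^-1 ^+ q)).
  by apply: eq_avg => b; rewrite prodrXl -prodfV.
rewrite prodr_const card_ord expRM_natr; apply: lerXn2r; rewrite ?nnegrE ?expR_ge0//.
  by apply: avg_ge0 => u; rewrite exprn_ge0// invr_ge0 ltW// sample_likelihood_gt0.
set t := q%:R * Lam; have t0 : 0 <= t by rewrite mulr_ge0.
have t2 : t <= 2^-1 by [].
have bern (x : R) : -1 <= x -> 1 + q%:R * x <= (1 + x) ^+ q.
  move=> x1; elim: (q) => [|k IH]; first by rewrite mul0r addr0 expr0.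
  rewrite exprS; apply: (@le_trans _ _ ((1 + x) * (1 + k%:R * x))); last first.
    by apply: ler_wpM2l => //; lra.
  by rewrite -natr1; have := mulr_ge0 (ler0n R k) (sqr_ge0 x); nra.
have tail (x : R) : `|x| = Lam -> (1 + x)^-1 ^+ q <= (1 + q%:R * x)^-1.
  move=> xL; have /andP[x1 x2] : - Lam <= x <= Lam by rewrite -ler_norml xL.
  have /andP[y1 y2] : - t <= q%:R * x <= t.
    by rewrite /t -mulrN !ler_wpM2l.
  rewrite exprVn lef_pV2 ?posrE ?exprn_gt0//; try lra.
  by apply: bern; lra.
apply: (@le_trans _ _ (1 + 2 * t ^+ 2)); last exact: expR_ge1Dx.
rewrite avg_pair; apply: avg_le_cst => [|g].
  by rewrite addr_ge0// mulr_ge0// sqr_ge0.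
rewrite avg_bool /sample_likelihood /bool_sign/=.
set p := parity S g; have p1 : p = 1 \/ p = -1.
  by have /eqP := parity_sqr S g; rewrite sqrf_eq1 => /orP[] /eqP; [left|right].
have h1 := tail Lam (ger0_norm L0).
have h2 := tail (- Lam); rewrite normrN ger0_norm// in h2.
have {h2} := h2 erefl; rewrite mulrN -/t => h2; rewrite -/t in h1.
have key : (1 + t)^-1 + (1 - t)^-1 <= 2 * (1 + 2 * t ^+ 2).
  have -> : (1 + t)^-1 + (1 - t)^-1 = 2 * (1 - t ^+ 2)^-1.
    by field; rewrite !gt_eqF//; nra.
  have u0 : 0 <= t ^+ 2 := sqr_ge0 t.
  have u4 : t ^+ 2 <= 4^-1 by nra.
  rewrite ler_wpM2l// -[leLHS]mul1r ler_pdivrMr; last lra.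
  have : 0 <= t ^+ 2 * (1 - 2 * t ^+ 2) by rewrite mulr_ge0//; lra.
  lra.
by case: p1 => ->; rewrite ?mulr1 ?mulrN1 ?mulrN ?mulr1 ?opprK; lra.
Qed.

End sample_block.
End parity.

(** * Success of a protocol on sign patterns *)

Section discrete_bound.
Context {R : realType} (D n : nat) (Lam : R).
Local Notation subsets := {set 'I_D}.
Local Notation block := {ffun 'I_n -> subsets * bool}.
Hypothesis Lam01 : 0 < Lam < 1.

(** Bound for one block from which at most [M] messages are formed.  The first
summand is what [M] messages reveal at degrees one and two, the second comes
from coincidences between features, and the last from degrees three and more. *)
Definition block_error (M : nat) : R :=
  2 * (8 * (Lam ^+ 2 + n%:R * Lam ^+ 4) * ln M%:R + (n ^ 4)%:R * 2^-1 ^+ D)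
  + 2 * (expR 1 * (n%:R * Lam ^+ 2) ^+ 3).

Lemma avg_block_split (h : block -> R) :
  avg h = avg (fun f : {ffun 'I_n -> subsets} => avg (fun y : {ffun 'I_n -> bool} =>
    h [ffun i => (f i, y i)])).
Proof.
pose zip (p : {ffun 'I_n -> subsets} * {ffun 'I_n -> bool}) : block :=
  [ffun i => (p.1 i, p.2 i)].
have zb : bijective zip.
  exists (fun b : block => ([ffun i => (b i).1], [ffun i => (b i).2])).
    by move=> [f y]; congr (_, _); apply/ffunP => i; rewrite !ffunE.
  by move=> b; apply/ffunP => i; rewrite !ffunE -surjective_pairing.
by rewrite -(avg_bij h zb) avg_pair.
Qed.

Lemma avg_block_deviation_le (W : finType) (G : block -> W) (M : nat) (c : subsets -> W -> R) :
  n%:R * Lam ^+ 2 <= 1 -> (#|[set G b | b : block]%SET| <= M)%N ->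
  avg (fun S => avg (fun b => 2 * (1 - block_likelihood Lam S b) * c S (G b) - c S (G b) ^+ 2))
  <= block_error M.
Proof.
move=> nL GM; case/andP: Lam01 => L0 L1.
have Lam01' : 0 <= Lam <= 1 by rewrite !ltW.
pose G' (f : {ffun 'I_n -> subsets}) (y : {ffun 'I_n -> bool}) := G [ffun i => (f i, y i)].
have G'M f : (#|[set G' f y | y : {ffun 'I_n -> bool}]%SET| <= M)%N.
  apply: leq_trans GM; apply/subset_leq_card/fintype.subsetP => w /imsetP[y _ ->].
  exact: imset_f.
have := avg_label_deviation (@parity_sqr R D) Lam01' finset.set0 c G'M
  (@parity_overlap_ge0 R D n) (@avg_parity_overlap R D n) _ L0 nL.
rewrite exprn_ge0 ?invr_ge0// => /(_ isT) h.
apply: le_trans _ h; rewrite le_eqVlt; apply/orP; left; apply/eqP.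
apply: eq_avg => S; rewrite avg_block_split; apply: eq_avg => f; apply: eq_avg => y.
rewrite /G'; set b := finfun _; suff -> : block_likelihood Lam S b = label_likelihood (@parity R D) Lam S f y.
  by [].
by apply: eq_bigr => i _; rewrite /sample_likelihood ffunE.
Qed.

Section protocol.
Context (J W : finType) (rect : J -> W -> pred block) (tr : {ffun J -> block} -> W).
Variables (out : W -> subsets) (M q : nat) (eps : R).
Hypothesis trP : forall x w, (tr x == w) = [forall j, rect j w (x j)].
Hypothesis trM : forall j x, (#|[set tr (set_coord x j b) | b : block]%SET| <= M)%N.

(** Under the null law the output is the hypothesis with average probability
[2^-1 ^+ D].  The excess is charged to the blocks: redrawing block [j] with the
others fixed reduces each summand of [likelihood_event_le] to
[avg_block_deviation_le]. *)
Lemma success_le : n%:R * Lam ^+ 2 <= 1 -> (0 < q)%N -> q%:R * Lam <= 2^-1 ->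
  (q%:R * Lam) ^+ 2 * n%:R <= 1 -> 0 < eps ->
  avg (fun S => avg (fun x : {ffun J -> block} =>
    (\prod_j block_likelihood Lam S (x j)) * (out (tr x) == S)%:R)) <=
  2^-1 ^+ D + eps + eps^-1 * (#|J|%:R *
     (2 * block_error M + 2 * 2^-1 ^+ q * expR 2)).
Proof.
move=> nL q0 qL q2L e0; case/andP: Lam01 => L0 L1.
have Lam01' : 0 <= Lam < 1 by rewrite ltW.
pose S0 : subsets := finset.set0.
pose b0 : block := [ffun=> (S0, true)].
pose x0 : {ffun J -> block} := [ffun=> b0].
have ge0 (S : subsets) (b : block) : 0 < block_likelihood Lam S b by exact: block_likelihood_gt0.
have h S := likelihood_event_le trP (ge0 S) (avg_block_likelihood n Lam S)
   (fun w => out w == S) x0 e0 q0.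
apply: le_trans (ler_avg h) _; rewrite 2!avgD (avg_cst S0) [X in _ + X]avgZ.
apply: lerD.
  rewrite lerD2r. rewrite avg_exchange; apply: avg_le_cst => [|x].
    by rewrite exprn_ge0 ?invr_ge0.
  rewrite /avg (bigD1 (out (tr x)))//= eqxx big1 ?addr0; last first.
    by move=> S; rewrite eq_sym => /negbTE ->.
  by rewrite mulr1 card_subsets natrX exprVn.
rewrite ler_pM2l ?invr_gt0// avg_sum [leRHS]mulr_natl -sumr_const; apply: ler_sum => j _.
rewrite avgD avgZ; apply: lerD.
  rewrite ler_wpM2l//.
  pose c S w : R := 1 - cond_likelihood rect (block_likelihood Lam S) j w.
  under eq_avg do rewrite (avg_resample _ j b0).
  rewrite avg_exchange -[leRHS](avg_cst x0); apply: ler_avg => x.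
  have := avg_block_deviation_le c nL (trM j x).
  congr (_ <= _); apply: eq_avg => S; apply: eq_avg => b.
  by rewrite ffunE eqxx.
apply: avg_le_cst => [|S].
  by rewrite !mulr_ge0 ?expR_ge0 ?exprn_ge0 ?invr_ge0.
rewrite ler_wpM2l ?mulr_ge0 ?exprn_ge0 ?invr_ge0//.
apply: le_trans (avg_block_likelihood_inv_pow n Lam01' S qL) _.
by rewrite ler_expR -mulrA ler_piMr.
Qed.

End protocol.
End discrete_bound.

(** * Block-boundary transcripts of a multi-pass algorithm *)

Section round_robin.
Context (St Bk : finType) (m' T : nat) (init : St) (stp : nat -> St -> Bk -> St).
Local Notation m := m'.+1.
Local Notation steps := (T * m)%N.
Local Notation transcript := {ffun 'I_steps -> St}.

(** Time runs through the passes one after the other, so step [k] reads block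
[k %% m]. *)
Definition owner (k : nat) : 'I_m := Ordinal (ltn_pmod k (ltn0Sn m')).

Fixpoint run (x : {ffun 'I_m -> Bk}) (k : nat) : St :=
  if k is k'.+1 then stp k' (run x k') (x (owner k')) else init.

Lemma runS x k : run x k.+1 = stp k (run x k) (x (owner k)).
Proof. by []. Qed.

Definition transcript_of x : transcript := [ffun k : 'I_steps => run x k.+1].

(** The inner [init] is a default for times after the last step. *)
Definition state_at (w : transcript) (k : nat) : St :=
  if k is k'.+1 then (if insub k' is Some i then w i else init) else init.

(** A condition on block [j] alone, which is why the fibers of [transcript_of] are
product sets. *)
Definition consistent (j : 'I_m) (w : transcript) : pred Bk :=
  fun b => [forall k : 'I_steps, (owner k == j) ==> (stp k (state_at w k) b == w k)].

Lemma state_at_transcript_of x k : (k <= steps)%N ->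
  state_at (transcript_of x) k = run x k.
Proof.
case: k => // k kT; rewrite /state_at; case: insubP => [i _ <-|]; last by rewrite kT.
by rewrite ffunE.
Qed.

Lemma transcript_ofP x w :
  (transcript_of x == w) = [forall j, consistent j w (x j)].
Proof.
apply/eqP/forallP => [<- j|cons].
  apply/forallP => k; apply/implyP => /eqP <-.
  by rewrite ffunE state_at_transcript_of// ltnW.
have runE k : (k <= steps)%N -> state_at w k = run x k.
  elim: k => [//|k IH kT].
  rewrite runS -(IH (ltnW kT)).
  rewrite -[LHS]/(if insub k is Some i then w i else init).
  case: insubP => [i _ ik|]; last by rewrite kT.
  have /forallP/(_ i) := cons (owner k).
  by rewrite ik eqxx => /eqP ->.
apply/ffunP => k; rewrite ffunE -runE// /state_at.
by rewrite insubT ?ltn_ord// => kT; congr (w _); apply: val_inj.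
Qed.

(** With the other blocks fixed, the transcript is determined by the states that
follow block [j], one in each pass. *)
Lemma card_block_transcripts j x :
  (#|[set transcript_of (set_coord x j b) | b : Bk]%SET| <= #|St| ^ T)%N.
Proof.
have slot (t : 'I_T) : (t * m + j < steps)%N.
  by have := ltn_ord t; have := ltn_ord j; nia.
pose own (w : transcript) : {ffun 'I_T -> St} := [ffun t => w (Ordinal (slot t))].
rewrite -(@card_in_imset _ _ own); last first.
  move=> _ _ /imsetP[b _ ->] /imsetP[b' _ ->] /ffunP own_eq.
  have agree k : (k <= steps)%N -> run (set_coord x j b) k = run (set_coord x j b') k.
    elim: k => // k IH kT; have [kj|kj] := eqVneq (owner k) j.
      have tT : (k %/ m < T)%N by rewrite ltn_divLR.
      have := own_eq (Ordinal tT); rewrite !ffunE.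
      suff -> : (Ordinal (slot (Ordinal tT)) : nat) = k by [].
      by rewrite /= -kj /= -divn_eq.
    by rewrite !runS (IH (ltnW kT)) !ffunE (negbTE kj).
  by apply/ffunP => k; rewrite !ffunE agree.
by rewrite (leq_trans (max_card _))// card_ffun card_ord.
Qed.

End round_robin.

Section padding.
Context {R : realType} (U : finType).

Lemma avg_curry (K1 K2 : finType) (h : {ffun K1 -> {ffun K2 -> U}} -> R) :
  avg h = avg (fun x : {ffun K1 * K2 -> U} => h [ffun i => [ffun j => x (i, j)]]).
Proof.
pose cur (x : {ffun K1 * K2 -> U}) : {ffun K1 -> {ffun K2 -> U}} :=
  [ffun i => [ffun j => x (i, j)]].
have cb : bijective cur.
  exists (fun y : {ffun K1 -> {ffun K2 -> U}} => [ffun p => y p.1 p.2]).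
    by move=> x; apply/ffunP => -[i j]; rewrite !ffunE.
  by move=> y; apply/ffunP => i; apply/ffunP => j; rewrite !ffunE.
by rewrite -(avg_bij h cb).
Qed.

(** Coordinates outside the range of [iota] carry factors of average 1.  This is
used to pad a sample to a whole number of blocks. *)
Lemma avg_marginal (I K : finType) (iota : I -> K) (ell : U -> R)
    (g : {ffun I -> U} -> R) : injective iota -> avg ell = 1 ->
  avg (fun x : {ffun K -> U} => (\prod_k ell (x k)) * g [ffun i => x (iota i)]) =
  avg (fun u : {ffun I -> U} => (\prod_i ell (u i)) * g u).
Proof.
move=> iota_inj ell1; pose w u := #|U|%:R^-1 * ell u.
have w1 : \sum_u w u = 1 by rewrite -mulr_sumr.
have avgE (L : finType) (G : {ffun L -> U} -> R) :
    avg (fun x : {ffun L -> U} => (\prod_k ell (x k)) * G x) = \sum_(x : {ffun L -> U}) (\prod_k w (x k)) * G x.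
  rewrite /avg mulr_sumr; apply: eq_bigr => x _; rewrite mulrA; congr (_ * _).
  by rewrite big_split/= card_ffun natrX -exprVn prodr_const.
rewrite (avgE K (fun x => g [ffun i => x (iota i)])) (avgE I g).
rewrite (partition_big (fun x : {ffun K -> U} => [ffun i => x (iota i)]) predT)//=.
apply: eq_bigr => u _.
rewrite (eq_bigr (fun x : {ffun K -> U} => (\prod_k w (x k)) * g u)); last first.
  by move=> x /eqP ->.
rewrite -mulr_suml; congr (_ * _).
pose Q (k : K) : pred U := fun a => [forall i, (iota i == k) ==> (a == u i)].
transitivity (\prod_k \sum_(a | Q k a) w a).
  rewrite bigA_distr_big_dep; apply: eq_bigl => x; apply/eqP/familyP => [/ffunP xu k|xQ].
    apply/forallP => i; apply/implyP => /eqP <-.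
    by have := xu i; rewrite ffunE => ->.
  by apply/ffunP => i; rewrite ffunE; have /forallP/(_ i) := xQ (iota i); rewrite eqxx => /eqP.
rewrite (bigID (mem [set iota i | i : I]%SET))/=.
rewrite [X in _ * X]big1 ?mulr1; last first.
  move=> k kI; rewrite -[RHS]w1; apply: eq_bigl => a; apply/forallP => i.
  by apply/implyP => /eqP ik; case/imsetP: kI; exists i.
rewrite big_imset/=; last by move=> i i' _ _; exact: iota_inj.
apply: eq_bigr => i _; rewrite (big_pred1 (u i))// => a.
apply/forallP/eqP => [/(_ i)|-> i']; first by rewrite eqxx => /eqP.
by apply/implyP => /eqP/iota_inj ->.
Qed.

End padding.

Section block_run.
Context d (X : measurableType d) (Out : Type) (N T s : nat)
  (alg : mb_algorithm X Out N T s) (U : finType) (phi : 'I_N -> U -> X).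
Variables (m' n' : nat).
Local Notation m := m'.+1.
Local Notation n := n'.+1.
Local Notation state := (s.-tuple bool).
Hypothesis Nmn : (N <= m * n)%N.

(** Positions from [N] on, which pad the last block, leave the state unchanged. *)
Definition nat_update (t i : nat) (st : state) (u : U) : state :=
  if (insub t : option 'I_T) is Some t' then
    if (insub i : option 'I_N) is Some i' then update alg t' i' st (phi i' u) else st
  else st.

Definition block_step (k : nat) (st : state) (b : {ffun 'I_n -> U}) : state :=
  foldl (fun st (r : 'I_n) => nat_update (k %/ m) (k %% m * n + r) st (b r)) st
    (enum 'I_n).

Definition slot (i : 'I_N) : 'I_m * 'I_n := (inord (i %/ n), inord (i %% n)).

Lemma slot_inj : injective slot.
Proof.
move=> i j [/(congr1 val) + /(congr1 val)]; rewrite /= !inordK ?ltn_pmod//.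
- move=> hd hm; apply/val_inj => /=.
  by rewrite (divn_eq i n) (divn_eq j n) hd hm.
- by rewrite ltn_divLR// (leq_trans (ltn_ord j)).
- by rewrite ltn_divLR// (leq_trans (ltn_ord i)).
Qed.

Definition sample_tuple (u : {ffun 'I_N -> U}) : N.-tuple X :=
  [tuple phi i (u i) | i < N].

Variable x : {ffun 'I_m -> {ffun 'I_n -> U}}.
Let u : {ffun 'I_N -> U} := [ffun i => x (slot i).1 (slot i).2].
Let nat_step t st i := nat_update t i st (x (inord (i %/ n)) (inord (i %% n))).
Local Notation init := [tuple of nseq s false].
Local Notation brun := (@run _ _ m' init block_step x).

Lemma foldl_map_arg (A B C : Type) (f : A -> C -> A) (g : B -> C) (a : A) l :
  foldl f a (map g l) = foldl (fun a b => f a (g b)) a l.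
Proof. by elim: l a => //= b l IH a. Qed.

Lemma eq_foldl_in (A : Type) (B : eqType) (f g : A -> B -> A) a (l : seq B) :
  (forall a, {in l, forall b, f a b = g a b}) -> foldl f a l = foldl g a l.
Proof.
elim: l a => //= b l IH a fg; rewrite fg ?mem_head// IH// => c e el.
by rewrite fg// inE el orbT.
Qed.

Lemma run_blocks t j : (j <= m)%N ->
  brun (t * m + j) = foldl (nat_step t) (brun (t * m)) (iota 0 (j * n)).
Proof.
elim: j => [|j IH] jm; first by rewrite addn0.
rewrite addnS runS (IH (ltnW jm)) (mulSn j) (addnC n (j * n)%N) iotaD foldl_cat add0n.
set st := foldl _ _ _; rewrite /block_step divnMDl// (divn_small jm) addn0.
rewrite modnMDl (modn_small jm) -[in RHS](addn0 (j * n)%N) iotaDl.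
rewrite foldl_map_arg -val_enum_ord foldl_map_arg.
apply: eq_foldl_in => a r _; rewrite /nat_step; congr (nat_update _ _ _ (x _ _)).
  apply: val_inj; rewrite /= inordK divnMDl// divn_small// addn0//.
  by rewrite modnMDl modn_small.
by apply: val_inj; rewrite /= modnMDl modn_small// inordK.
Qed.

Lemma run_pass (t : 'I_T) :
  brun (t.+1 * m) = pass alg (sample_tuple u) t (brun (t * m)).
Proof.
rewrite mulSn addnC run_blocks// /pass.
rewrite -(subnKC Nmn) iotaD foldl_cat add0n.
have skip l a : all (leq N) l -> foldl (nat_step t) a l = a.
  elim: l a => //= i l IH a /andP[Ni lN].
  rewrite IH// /nat_step /nat_update; case: insub => // t'.
  by case: insubP => // i'; rewrite ltnNge Ni.
rewrite skip; last by apply/allP => i; rewrite mem_iota => /andP[].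
rewrite -val_enum_ord foldl_map_arg; apply: eq_foldl_in => st i _.
rewrite /nat_step /nat_update !valK tnth_mktuple.
by rewrite /u ffunE.
Qed.

Lemma run_final_state : brun (T * m) = final_state alg (sample_tuple u).
Proof.
have step k : (k <= T)%N -> brun (k * m) =
    foldl (fun st t => pass alg (sample_tuple u) t st) init (take k (enum 'I_T)).
  elim: k => [|k IH] kT; first by rewrite take0.
  rewrite (run_pass (Ordinal kT)) IH ?(ltnW kT)//.
  rewrite (take_nth (Ordinal kT)) ?size_enum_ord// -cats1 foldl_cat/=.
  by congr pass; apply: val_inj; rewrite /= nth_enum_ord.
by rewrite step// take_oversize// size_enum_ord.
Qed.

End block_run.

Section mb_discrete.
Context {R : realType} d (X : measurableType d) (D N T s : nat).
Local Notation subsets := {set 'I_D}.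
Local Notation sample := (subsets * bool)%type.
Variables (alg : mb_algorithm X subsets N T s) (phi : 'I_N -> sample -> X).

Lemma mb_success_le (Lam eps : R) (m n q : nat) :
  0 < Lam < 1 -> (0 < m)%N -> (0 < n)%N -> (N <= m * n)%N ->
  n%:R * Lam ^+ 2 <= 1 -> (0 < q)%N -> q%:R * Lam <= 2^-1 ->
  (q%:R * Lam) ^+ 2 * n%:R <= 1 -> 0 < eps ->
  avg (fun S => avg (fun u : {ffun 'I_N -> sample} =>
    (\prod_i sample_likelihood Lam S (u i)) *
    (mb_output alg (sample_tuple phi u) == S)%:R)) <=
  2^-1 ^+ D + eps + eps^-1 * (m%:R *
     (2 * block_error D n Lam (2 ^ (s * T)) + 2 * 2^-1 ^+ q * expR 2)).
Proof.
move=> Lam01; case: m => // m' _; case: n => // n' _ Nmn nL q0 qL q2L e0.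
set m := m'.+1; set n := n'.+1.
pose stp := @block_step _ X subsets N T s alg sample phi m' n'.
pose init : s.-tuple bool := [tuple of nseq s false].
pose out (w : {ffun 'I_(T * m) -> s.-tuple bool}) : subsets :=
  estimator alg (state_at init w (T * m)).
have trM j (x : {ffun 'I_m -> {ffun 'I_n -> sample}}) : (#|[set transcript_of T init stp (set_coord x j b) |
    b : {ffun 'I_n -> sample}]%SET| <= 2 ^ (s * T))%N.
  apply: leq_trans (card_block_transcripts _ _ _ _ _) _.
  by rewrite card_tuple card_bool expnM.
have := success_le Lam01 out (transcript_ofP init stp) trM nL q0 qL q2L e0.
rewrite card_ord; apply: le_trans; rewrite le_eqVlt; apply/orP; left; apply/eqP.
apply: eq_avg => S.
rewrite (avg_curry (fun x => (\prod_j block_likelihood Lam S (x j)) *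
   (out (transcript_of T init stp x) == S)%:R)).
have Lam01' : 0 <= Lam < 1 by case/andP: Lam01 => ? ->; rewrite ltW.
rewrite -(avg_marginal _ (@slot_inj N m' n' Nmn) (avg_sample_likelihood Lam S)).
apply: eq_avg => x; congr (_ * _).
  rewrite /block_likelihood pair_big/=; apply: eq_bigr => -[j k] _.
  by rewrite !ffunE.
congr ((_ == _)%:R); rewrite /out state_at_transcript_of//.
rewrite /stp (run_final_state alg phi Nmn) /mb_output; congr (estimator _ (final_state _ (sample_tuple _ _))).
by apply/ffunP => i; rewrite !ffunE -surjective_pairing.
Qed.

End mb_discrete.

Local Open Scope classical_set_scope.
Local Open Scope ring_scope.

(** * From product measures to finite averages *)

Section ffun_cons.
Context (U : Type) (n : nat).

Definition ffun_cons (u : U) (f : {ffun 'I_n -> U}) : {ffun 'I_n.+1 -> U} :=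
  [ffun i => if unlift ord0 i is Some j then f j else u].

Lemma ffun_cons0 u f : ffun_cons u f ord0 = u.
Proof. by rewrite ffunE unlift_none. Qed.

Lemma ffun_consS u f i : ffun_cons u f (lift ord0 i) = f i.
Proof. by rewrite ffunE liftK. Qed.

End ffun_cons.

Lemma big_ffun_cons (V : Type) (idx : V) (op : Monoid.com_law idx) (U : finType) n
    (F : {ffun 'I_n.+1 -> U} -> V) :
  \big[op/idx]_f F f = \big[op/idx]_u \big[op/idx]_f F (ffun_cons u f).
Proof.
rewrite pair_big (reindex (fun p : U * {ffun 'I_n -> U} => ffun_cons p.1 p.2))//=.
exists (fun f : {ffun 'I_n.+1 -> U} => (f ord0, [ffun i => f (lift ord0 i)])).
  move=> [u f] _; rewrite ffun_cons0; congr (_, _); apply/ffunP => i.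
  by rewrite ffunE ffun_consS.
move=> f _; apply/ffunP => i; case: (unliftP ord0 i) => [j ->|->].
  by rewrite ffun_consS ffunE.
by rewrite ffun_cons0.
Qed.

Section mixture.
Context dX dZ (X : measurableType dX) (Z : measurableType dZ) (R : realType).
Context (U : finType) (w : U -> R) (phi : U -> {mfun Z >-> X}).
Hypothesis w_ge0 : forall u, 0 <= w u.
Variables (mu : {measure set X -> \bar R}) (gam : probability Z R).
Local Open Scope ereal_scope.
Hypothesis muE : forall A, measurable A ->
  mu A = \sum_u (w u)%:E * gam (phi u @^-1` A).

Let component (k : nat) : {measure set X -> \bar R} :=
  if (insub k : option 'I_#|U|) is Some i then
    mscale (NngNum (w_ge0 (enum_val i))) (distribution gam (phi (enum_val i)))
  else mzero.

(** [mu] coincides with a finite sum of scaled image measures, and such a sum can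
be integrated term by term. *)
Lemma ge0_integral_mixture (G : X -> \bar R) : measurable_fun [set: X] G ->
  (forall x, 0 <= G x) ->
  \int[mu]_x G x = \sum_u (w u)%:E * \int[gam]_z G (phi u z).
Proof.
move=> mG G0.
rewrite (eq_measure_integral (msum component #|U|)); last first.
  move=> A mA _; rewrite muE// big_enum_val /msum/=.
  by apply: eq_bigr => i _; rewrite /component valK.
rewrite ge0_integral_measure_sum// [RHS]big_enum_val/=.
apply: eq_bigr => i _; rewrite /component valK ge0_integral_mscale//=.
congr (_ * _); exact: ge0_integral_distribution.
Qed.

End mixture.

Section iid_integral.
Context d (X : measurableType d) (R : realType) (P : probability X R) (n : nat).
Local Open Scope ereal_scope.
Variable g : n.+1.-tuple X -> \bar R.
Hypotheses (mg : measurable_fun [set: n.+1.-tuple X] g) (g0 : forall x, 0 <= g x).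

Let mgc : measurable_fun [set: X * n.-tuple X] (fun p => g (tuple_cons p)).
Proof. by apply: (measurableT_comp mg); exact: measurable_funP. Qed.

Lemma measurable_iid_section :
  measurable_fun [set: X] (fun x => \int[iid_prob P n]_y g (tuple_cons (x, y))).
Proof. apply: (measurable_fun_fubini_tonelli_F (m2 := iid_prob P n) (fun p => g (tuple_cons p))) => //. Qed.

Lemma measurable_tuple_section x :
  measurable_fun [set: n.-tuple X] (fun y => g (tuple_cons (x, y))).
Proof. by apply: (measurableT_comp mgc); exact: measurable_pair1. Qed.

Lemma ge0_integral_iid_probS :
  \int[iid_prob P n.+1]_x g x =
  \int[P]_x \int[iid_prob P n]_y g (tuple_cons (x, y)).
Proof.
rewrite [LHS]ge0_integral_distribution//.
exact: (fubini_tonelli1 (m1 := P) (m2 := iid_prob P n) (fun p => g (tuple_cons p))).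
Qed.

End iid_integral.

Section iid_reduction.
Context dX dZ (X : measurableType dX) (Z : measurableType dZ) (R : realType).
Context (Theta U : finType) (w : Theta -> U -> R) (phi : U -> {mfun Z >-> X}).
Hypothesis w_ge0 : forall S u, 0 <= w S u.
Variables (P : Theta -> probability X R) (gam : probability Z R).
Local Open Scope ereal_scope.
Hypothesis PE : forall S A, measurable A ->
  P S A = \sum_u (w S u)%:E * gam (phi u @^-1` A).

(** Integrate the samples one at a time: write the law of a sample as a mixture
over a latent [z] and bound the integral over [z] by a supremum.  The sum over
the hypotheses stays inside, so that the worst [z] is common to all of them. *)
Lemma iid_sum_le N (B : \bar R) (g : Theta -> N.-tuple X -> \bar R) : 0 <= B ->
  (forall S, measurable_fun [set: N.-tuple X] (g S)) ->
  (forall S x, 0 <= g S x) ->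
  (forall z : 'I_N -> Z, \sum_S \sum_(u : {ffun 'I_N -> U})
     (\prod_i w S (u i))%:E * g S [tuple phi (u i) (z i) | i < N] <= B) ->
  \sum_S \int[iid_prob (P S) N]_x g S x <= B.
Proof.
elim: N g => [|N IH] g B0 mg g0 gB.
  have [z0 _] : exists z : 'I_0 -> Z, True.
    by exists (fun i : 'I_0 => False_rect Z (notF (ltn_ord i))).
  apply: le_trans (gB z0); apply: lee_sum => S _.
  rewrite [leLHS]integral_dirac// diracT mul1e.
  have [u0 _] : exists u0 : {ffun 'I_0 -> U}, True.
    by exists [ffun i : 'I_0 => False_rect U (notF (ltn_ord i))].
  rewrite (bigD1 u0)//= big_ord0 mul1e -[leLHS]adde0.
  apply: leeD; first by rewrite (tuple0 [tuple _ | _ < 0]).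
  apply: sume_ge0 => u _; rewrite mule_ge0// lee_fin.
  by apply: prodr_ge0.
under eq_bigr do rewrite ge0_integral_iid_probS//.
pose G S x := \int[iid_prob (P S) N]_y g S (tuple_cons (x, y)).
have mG S : measurable_fun [set: X] (G S) by exact: measurable_iid_section.
have G0 S x : 0 <= G S x by apply: integral_ge0 => y _; exact: g0.
have mGphi S u : measurable_fun [set: Z] (fun z => G S (phi u z)).
  by apply: (measurableT_comp (mG S)); exact: measurable_funP.
pose F S z := \sum_u (w S u)%:E * G S (phi u z).
have mF S : measurable_fun [set: Z] (F S).
  by apply: emeasurable_sum => u; exact: measurable_funeM.
have F0 S z : 0 <= F S z by apply: sume_ge0 => u _; rewrite mule_ge0// lee_fin.
apply: (@le_trans _ _ (\int[gam]_z \sum_S F S z)).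
  rewrite ge0_integral_sum//; apply: lee_sum => S _.
  rewrite (ge0_integral_mixture (w_ge0 S) (PE S) (mG S) (G0 S)) /F ge0_integral_sum//; last 2 first.
  - by move=> u; exact: measurable_funeM.
  - by move=> u z _; rewrite mule_ge0// lee_fin.
  by apply: lee_sum => u _; rewrite ge0_integralZl// lee_fin.
apply: (@le_trans _ _ (\int[gam]_z B)); last first.
  rewrite integral_cst//. by rewrite -[leRHS]mule1 lee_wpmul2l// probability_le1.
apply: ge0_le_integral => //.
- by move=> z _; apply: sume_ge0.
- exact: emeasurable_sum.
move=> z0 _; rewrite /F.
pose g' S y := \sum_u (w S u)%:E * g S (tuple_cons (phi u z0, y)).
have mg' S u : measurable_fun [set: N.-tuple X] (fun y => g S (tuple_cons (phi u z0, y))).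
  exact: measurable_tuple_section.
rewrite (eq_bigr (fun S => \int[iid_prob (P S) N]_y g' S y)); last first.
  move=> S _; rewrite /g' ge0_integral_sum//; last 2 first.
  - by move=> u; exact: measurable_funeM.
  - by move=> u y _; rewrite mule_ge0// lee_fin.
  by apply: eq_bigr => u _; rewrite ge0_integralZl// lee_fin.
apply: IH => //.
- by move=> S; apply: emeasurable_sum => u; exact: measurable_funeM.
- by move=> S y; apply: sume_ge0 => u _; rewrite mule_ge0// lee_fin.
move=> z; pose z' (i : 'I_N.+1) := if unlift ord0 i is Some j then z j else z0.
apply: le_trans (gB z'); apply: lee_sum => S _.
rewrite big_ffun_cons exchange_big/= le_eqVlt; apply/orP; left; apply/eqP.
apply: eq_bigr => f _; rewrite /g' ge0_sume_distrr; last first.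
  by move=> u _; rewrite mule_ge0// lee_fin.
apply: eq_bigr => u _; rewrite muleA; congr (_ * g S _).
  rewrite big_ord_recl ffun_cons0 -EFinM mulrC; congr ((_ * _)%:E).
  by apply: eq_bigr => i _; rewrite ffun_consS.
apply: eq_from_tnth => i; rewrite tnth_mktuple /z'.
case: (unliftP ord0 i) => [j ->|->]; last by rewrite ffun_cons0 tnth0.
by rewrite ffun_consS tnthS tnth_mktuple.
Qed.

End iid_reduction.

(** * Sign symmetry of the Gaussian features *)

Section gaussian_symmetry.
Context {R : realType}.
Local Notation RR := (measurableTypeR R).
Local Notation N01 := (normal_prob (0 : R) 1).
Local Open Scope ereal_scope.

Definition real_opp : RR -> RR := fun x => (- (x : R))%R.

Lemma measurable_real_opp : measurable_fun [set: RR] real_opp.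
Proof. exact: oppr_measurable. Qed.

HB.instance Definition _ := isMeasurableFun.Build _ _ _ _ real_opp measurable_real_opp.

Lemma normal_probN (A : set RR) : measurable A -> N01 (real_opp @^-1` A) = N01 A.
Proof.
move=> mA; rewrite /normal_prob.
have mpdf : measurable_fun [set: RR] (fun x : RR => (normal_pdf (0 : R) 1 x)%:E).
  by apply/measurable_EFinP; exact: measurable_normal_pdf.
rewrite [RHS](eq_measure_integral (pushforward (@lebesgue_measure R) real_opp)); last first.
  by move=> B mB _; exact/esym/lebesgue_measureN.
rewrite ge0_integral_pushforward; last 4 first.
- exact: measurable_real_opp.
- exact: mA.
- exact: measurable_funTS.
- by move=> x _; rewrite lee_fin normal_pdf_ge0.
- apply: eq_integral => x _ /=; rewrite /real_opp /normal_pdf oner_eq0.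
  by rewrite /normal_fun !subr0 sqrrN.
Qed.

Lemma ge0_integral_normalN (h : RR -> \bar R) : measurable_fun [set: RR] h ->
  (forall x, 0 <= h x) -> \int[N01]_x h (real_opp x) = \int[N01]_x h x.
Proof.
move=> mh h0; rewrite [RHS](eq_measure_integral (distribution N01 real_opp)).
  by rewrite ge0_integral_distribution.
by move=> A mA _; exact/esym/normal_probN.
Qed.

Definition sign_flip n (sigma : 'I_n -> bool) (f : n.-tuple RR) : n.-tuple RR :=
  [tuple if sigma i then real_opp (tnth f i) else tnth f i | i < n].

Lemma measurable_sign_flip n (sigma : 'I_n -> bool) :
  measurable_fun [set: n.-tuple RR] (sign_flip sigma).
Proof.
apply/measurable_fun_tnthP => i.
rewrite (_ : _ \o _ = fun f : n.-tuple RR =>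
  if sigma i then real_opp (tnth f i) else tnth f i).
  case: (sigma i); last exact: measurable_tnth.
  by apply: (measurableT_comp measurable_real_opp); exact: measurable_tnth.
by apply/funext => f /=; rewrite tnth_mktuple.
Qed.

Lemma ge0_integral_sign_flip n (sigma : 'I_n -> bool) (h : n.-tuple RR -> \bar R) :
  measurable_fun [set: n.-tuple RR] h -> (forall x, 0 <= h x) ->
  \int[iid_prob N01 n]_f h (sign_flip sigma f) = \int[iid_prob N01 n]_f h f.
Proof.
elim: n sigma h => [|n IH] sigma h mh h0.
  by apply: eq_integral => f _; congr h; rewrite (tuple0 f) [LHS]tuple0.
rewrite ge0_integral_iid_probS//; last first.
  by apply: (measurableT_comp mh); exact: measurable_sign_flip.
pose sigma' i := sigma (lift ord0 i).
pose x' x := if sigma ord0 then real_opp x else x.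
have consE x f : sign_flip sigma (tuple_cons (x, f)) =
    tuple_cons (x' x, sign_flip sigma' f).
  apply: eq_from_tnth => i; rewrite tnth_mktuple.
  by case: (unliftP ord0 i) => [j ->|->]; rewrite ?tnthS ?tnth0 ?tnth_mktuple.
under eq_integral do under eq_integral do rewrite consE.
under eq_integral => x _.
  rewrite (IH sigma' (fun f => h (tuple_cons (x' x, f))))//; last first.
    exact: measurable_tuple_section.
  over.
rewrite [RHS]ge0_integral_iid_probS// /x'; case: (sigma ord0); last reflexivity.
apply: (ge0_integral_normalN (h := fun x => \int[iid_prob N01 n]_y h (tuple_cons (x, y)))).
  exact: measurable_iid_section.
by move=> x; exact: integral_ge0.
Qed.

Lemma normal_prob_set1 (a : R) : N01 [set a] = 0.
Proof.
have /null_content_dominatesP := @normal_prob_dominates R 0 1.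
by apply => //; exact: lebesgue_measure_set1.
Qed.

Lemma std_gaussian_coord0 D (j : 'I_D) :
  @std_gaussian R D [set f | tnth f j = 0%R] = 0.
Proof.
rewrite /std_gaussian (_ : [set f | _] = [set f : features R D | forall i,
    (if i == j then [set (0%R : RR)] else [set: RR]) (tnth f i)]); last first.
  apply/seteqP; split => f /=; last by move=> /(_ j); rewrite eqxx.
  by move=> fj i; case: eqP => // ->.
rewrite (iid_probE N01 (A := fun i => if i == j then [set (0%R : RR)] else [set: RR])).
  by rewrite (bigD1 j)//= eqxx [X in X * _]normal_prob_set1 mul0e.
by move=> i; case: ifP.
Qed.

End gaussian_symmetry.

Section parity_mixture.
Context {R : realType} (D : nat).
Local Notation RR := (measurableTypeR R).
Local Notation subsets := {set 'I_D}.
Local Notation gauss := (@std_gaussian R D).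

Definition abs_tuple (f : features R D) : features R D :=
  [tuple (`|tnth f i : R| : RR) | i < D].

Lemma measurable_abs_tuple : measurable_fun [set: features R D] abs_tuple.
Proof.
apply/measurable_fun_tnthP => i.
rewrite (_ : _ \o _ = ((fun x : R => `|x|) : RR -> RR) \o (fun f : features R D => tnth f i)).
  by apply: measurableT_comp; [exact: normr_measurable|exact: measurable_tnth].
by apply/funext => f /=; rewrite tnth_mktuple.
Qed.

Definition signed_sample (u : subsets * bool) (f : features R D) : features R D * bool :=
  (sign_flip (fun i => i \in u.1) (abs_tuple f), u.2).

Lemma measurable_signed_sample u : measurable_fun [set: features R D] (signed_sample u).
Proof.
apply: measurable_fun_pair => //.
by apply: measurableT_comp; [exact: measurable_sign_flip|exact: measurable_abs_tuple].
Qed.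

HB.instance Definition _ u :=
  isMeasurableFun.Build _ _ _ _ (signed_sample u) (measurable_signed_sample u).

Definition sym_diff (t s : subsets) : subsets :=
  [set i | (i \in s) (+) (i \in t)]%SET.

Lemma sym_diffK t : involutive (sym_diff t).
Proof.
by move=> s; apply/setP => i; rewrite !inE -addbA addbb addbF.
Qed.

(** Taking absolute values is itself a sign flip. *)
Lemma sum_sign_flip_abs (V : nmodType) (h : features R D -> V) f :
  \sum_(s : subsets) h (sign_flip (fun i => i \in s) (abs_tuple f)) =
  \sum_(s : subsets) h (sign_flip (fun i => i \in s) f).
Proof.
pose t : subsets := [set i | (tnth f i : R) < 0]%SET.
rewrite (reindex_inj (inv_inj (sym_diffK t))); apply: eq_bigr => s _; congr h.
apply: eq_from_tnth => i; rewrite !tnth_mktuple !inE /real_opp.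
by case: ltrP => fi; case: (i \in s) => /=; rewrite ?(ltr0_norm fi) ?(ger0_norm fi) ?opprK.
Qed.

Definition sample_weight (Lam : R) (S : subsets) (u : subsets * bool) : R :=
  #|{: subsets * bool}|%:R^-1 * sample_likelihood Lam S u.

Lemma parity_bias_signed (Lam : R) (S s : subsets) (f : features R D) :
  (forall j, tnth f j != 0 :> R) ->
  parity_bias Lam S (sign_flip (fun i => i \in s) (abs_tuple f)) =
  2^-1 + Lam / 2 * parity S s.
Proof.
move=> f0; rewrite /parity_bias /parity; congr (_ + _ * _).
apply: eq_bigr => j _; rewrite !tnth_mktuple /real_opp /bool_sign.
case: (j \in s) => /=; rewrite ?sgrN gtr0_sg ?normr_gt0//.
Qed.

Lemma parity_bias_range (Lam : R) (S : subsets) (f : features R D) : 0 <= Lam <= 1 -> 0 <= parity_bias Lam S f <= 1.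
Proof.
move=> /andP[L0 L1]; rewrite /parity_bias; set p := \prod_(j in S) _.
have : `|p| <= 1.
  rewrite normr_prod; apply: prodr_ile1 => j; rewrite normr_ge0/= normr_sg.
  by case: eqP.
rewrite ler_norml => /andP[p1 p2].
have h1 : 0 <= Lam * (1 - p) by rewrite mulr_ge0// subr_ge0.
have h2 : 0 <= Lam * (1 + p) by rewrite mulr_ge0//; lra.
by apply/andP; split; lra.
Qed.

Definition label_prob (Lam : R) (S : subsets) (r : bool) (f : features R D) : R :=
  if r then parity_bias Lam S f else 1 - parity_bias Lam S f.

Variables (Lam : R) (S : subsets).
Hypothesis Lam01 : 0 <= Lam <= 1.

Lemma label_prob_ge0 r f : 0 <= label_prob Lam S r f.
Proof.
by have /andP[? ?] := parity_bias_range S f Lam01; case: r; rewrite /= ?subr_ge0.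
Qed.

Lemma measurable_label_prob r :
  measurable_fun [set: features R D] (label_prob Lam S r).
Proof.
case: r; first exact: measurable_parity_bias.
by apply: measurable_funB => //; exact: measurable_parity_bias.
Qed.

Lemma sample_likelihood_ge0 u : 0 <= sample_likelihood Lam S u.
Proof.
case/andP: Lam01 => L0 L1; rewrite /sample_likelihood -lerBlDl sub0r.
have : `|Lam * (bool_sign u.2 * parity S u.1)| <= 1.
  by rewrite normrM norm_label_parity mulr1 ger0_norm.
by rewrite ler_norml => /andP[].
Qed.

(** A sign-symmetric vector is a uniform sign pattern applied to its absolute
values.  Almost surely no coordinate vanishes, and then the bias of the label
depends on the sign pattern only. *)
Lemma parity_sampleE (A : set (features R D * bool)) : measurable A ->
  parity_sample Lam S A =
  (\sum_u (sample_weight Lam S u)%:E * gauss (signed_sample u @^-1` A))%E.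
Proof.
move=> mA.
pose ind r (f : features R D) : R := \1_A (f, r).
have ind0 r f : 0 <= ind r f by rewrite /ind indicE ler0n.
have mind r : measurable_fun [set: features R D] (ind r).
  apply: (measurableT_comp (measurable_indic mA)).
  exact: measurable_pair2.
pose K f : R := \sum_(r : bool) label_prob Lam S r f * ind r f.
have K0 f : 0 <= K f.
  by apply: sumr_ge0 => r _; rewrite mulr_ge0// label_prob_ge0.
have mK : measurable_fun [set: features R D] K.
  apply: measurable_sum => r; apply: measurable_funM => //.
  exact: measurable_label_prob.
have mKE : measurable_fun [set: features R D] (EFin \o K) by exact/measurable_EFinP.
transitivity (\int[gauss]_f (K f)%:E)%E.
  apply: eq_integral => f _; rewrite /parity_label/=.
  transitivity (bernoulli_prob (parity_bias Lam S f) (xsection A f)); first by [].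
  rewrite bernoulli_probE; last exact: parity_bias_range.
  rewrite !diracE !mem_xsection /K big_bool/= EFinD !EFinM.
  by rewrite /ind !indicE.
have mflip (s : subsets) : measurable_fun [set: features R D]
    (fun f => (K (sign_flip (fun i => i \in s) f))%:E).
  by apply: (measurableT_comp mKE); exact: measurable_sign_flip.
pose c : R := #|{: subsets}|%:R^-1.
have c0 : 0 <= c by rewrite invr_ge0.
transitivity (\int[gauss]_f \sum_(s : subsets)
    c%:E * (K (sign_flip (fun i => i \in s) f))%:E)%E.
  rewrite ge0_integral_sum//; last 2 first.
  - by move=> s; exact: measurable_funeM.
  - by move=> s f _; rewrite mule_ge0// lee_fin.
  transitivity (\sum_(s : subsets) c%:E * \int[gauss]_f (K f)%:E)%E.
    rewrite -ge0_sume_distrl; last by move=> s _; rewrite lee_fin.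
    rewrite sumEFin sumr_const -[c *+ _]mulr_natl mulfV ?mul1e//.
    by rewrite pnatr_eq0; apply/eqP => /card0_eq/(_ finset.set0).
  apply: eq_bigr => s _; rewrite ge0_integralZl//; last by move=> f _; rewrite lee_fin.
  by rewrite (ge0_integral_sign_flip _ mKE)// => f; rewrite lee_fin.
have mW u : measurable_fun [set: features R D]
    (fun f => (\1_A (signed_sample u f) : R)%:E).
  apply/measurable_EFinP; apply: (measurableT_comp (measurable_indic mA)).
  exact: measurable_signed_sample.
have w0 u : 0 <= sample_weight Lam S u.
  by apply: mulr_ge0; [rewrite invr_ge0|exact: sample_likelihood_ge0].
transitivity (\int[gauss]_f \sum_(u : subsets * bool)
    (sample_weight Lam S u)%:E * (\1_A (signed_sample u f))%:E)%E.
  apply: ge0_ae_eq_integral => //.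
  - by apply: emeasurable_sum => s; exact: measurable_funeM.
  - by apply: emeasurable_sum => u; exact: measurable_funeM.
  - by move=> f _; apply: sume_ge0 => s _; rewrite mule_ge0// lee_fin.
  - by move=> f _; apply: sume_ge0 => u _; rewrite mule_ge0// lee_fin.
  (* A vanishing coordinate would have sign 0 and make the label unbiased. *)
  have nz : {ae gauss, forall f, forall j, tnth f j != 0 :> R}.
    apply: filter_forall => j; exists [set f | tnth f j = 0]; split.
    - rewrite (_ : [set f | _] = (fun f : features R D => tnth f j) @^-1` [set (0 : RR)])//.
      by rewrite -[X in measurable X]setTI; exact: measurable_tnth.
    - exact: std_gaussian_coord0.
    - by move=> f /= /negP; rewrite negbK => /eqP.
  move: nz; apply: (@filterS _ _ (ae_filter_ringOfSetsType gauss)) => f f0 _.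
  under eq_bigr do rewrite -EFinM.
  under [RHS]eq_bigr do rewrite -EFinM.
  rewrite !sumEFin -mulr_sumr; congr (_%:E).
  rewrite -(sum_sign_flip_abs K) mulr_sumr.
  rewrite -(pair_bigA _ (fun s r => sample_weight Lam S (s, r) *
     \1_A (signed_sample (s, r) f)))/=.
  apply: eq_bigr => s _; rewrite mulr_sumr; apply: eq_bigr => r _.
  rewrite mulrA; congr (_ * _).
  rewrite /sample_weight /sample_likelihood card_prod card_bool natrM invfM -/c.
  by case: r; rewrite /label_prob parity_bias_signed//= /bool_sign; field.
rewrite ge0_integral_sum//; last 2 first.
- by move=> u; exact: measurable_funeM.
- by move=> u f _; rewrite mule_ge0// lee_fin.
apply: eq_bigr => u _; rewrite ge0_integralZl//; last by rewrite lee_fin.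
have mphi : measurable (signed_sample u @^-1` A).
  by rewrite -[X in measurable X]setTI; exact: measurable_signed_sample.
have -> : (fun f => (\1_A (signed_sample u f))%:E) =
  (fun f => (\1_(signed_sample u @^-1` A) f : R)%:E) by [].
by rewrite integral_indic// setIT.
Qed.

End parity_mixture.

(** * Worst-case success is at most average success *)

Section measurable_runs.
Context d (Z : measurableType d) (St : finType).

Lemma measurable_foldl (A : Type) (f : A -> St -> Z -> St) (l : seq A) :
  (forall a st st', measurable [set z | f a st z = st']) ->
  forall st st', measurable [set z | foldl (fun st a => f a st z) st l = st'].
Proof.
move=> mf; elim: l => [|a l IH] st st' /=.
  have [->|/eqP stst] := eqVneq st st'.
    by rewrite (_ : [set _ | _] = setT) //; apply/seteqP; split.
  by rewrite (_ : [set _ | _] = set0) //; apply/seteqP; split.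
rewrite (_ : [set _ | _] = \bigcup_(st1 in [set: St])
    ([set z | f a st z = st1] `&`
     [set z | foldl (fun st a => f a st z) st1 l = st'])).
  apply: fin_bigcup_measurable => // st1 _; exact: measurableI.
apply/seteqP; split => z /=; first by move=> h; exists (f a st z).
by move=> [st1 _ /= [<-]].
Qed.

End measurable_runs.

Section measurable_output.
Context d (X : measurableType d) (Out : Type) (N T s : nat).
Variable alg : mb_algorithm X Out N T s.

Lemma measurable_state (st : s.-tuple bool) : measurable [set st].
Proof.
rewrite (_ : [set st] = \bigcap_(i in [set: 'I_s])
    ((fun st' : s.-tuple bool => tnth st' i) @^-1` [set tnth st i])).
  apply: fin_bigcap_measurable => // i _.
  by rewrite -[X in measurable X]setTI; exact: measurable_tnth.
apply/seteqP; split => st' /=; first by move=> -> i _.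
by move=> h; apply: eq_from_tnth => i; exact: h.
Qed.

Lemma measurable_update_event t i st st' :
  measurable [set x : N.-tuple X | update alg t i st (tnth x i) = st'].
Proof.
rewrite (_ : [set _ | _] = (update alg t i st \o (fun x : N.-tuple X => tnth x i)) @^-1` [set st'])//.
rewrite -[X in measurable X]setTI.
have mu : measurable_fun [set: N.-tuple X] (update alg t i st \o (fun x : N.-tuple X => tnth x i)).
  apply: measurableT_comp; last exact: measurable_tnth.
  exact: measurable_update.
by apply: mu => //; exact: measurable_state.
Qed.

Lemma measurable_mb_output (o : Out) :
  measurable [set x : N.-tuple X | o = mb_output alg x].
Proof.
rewrite (_ : [set _ | _] = \bigcup_(st in [set st | o = estimator alg st])
    [set x : N.-tuple X | final_state alg x = st]).
  apply: fin_bigcup_measurable => [|st _]; first exact: finite_finset.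
  rewrite /final_state.
  apply: (measurable_foldl (f := fun t st x => pass alg x t st)) => t {}st st'.
  rewrite /pass.
  apply: (measurable_foldl (f := fun i st (x : N.-tuple X) => update alg t i st (tnth x i))).
  by move=> i st1 st1'; exact: measurable_update_event.
apply/seteqP; split => x /=; first by move=> h; exists (final_state alg x).
by move=> [st /= -> <-].
Qed.

End measurable_output.

Section success_bound.
Context {R : realType} (D N T s : nat) (Lam : R).
Local Notation subsets := {set 'I_D}.
Local Notation sample := (subsets * bool)%type.
Variable alg : mb_algorithm (features R D * bool)%type subsets N T s.
Hypothesis Lam01 : 0 <= Lam <= 1.

(** The infimum over [S] is at most the uniform average over [S].  Fixing the
absolute values of all the features makes a sample a function [phi] of a sign
pattern and a label. *)
Lemma worst_success_le (B : R) :
  (forall phi : 'I_N -> sample -> features R D * bool,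
    avg (fun S => avg (fun u : {ffun 'I_N -> sample} =>
      (\prod_i sample_likelihood Lam S (u i)) *
      (mb_output alg (sample_tuple phi u) == S)%:R)) <= B) ->
  (ereal_inf [set parity_data Lam S N [set x | S = mb_output alg x]
             | S in [set: subsets]] <= B%:E)%E.
Proof.
move=> hB.
have B0 : 0 <= B.
  apply: le_trans (hB (fun _ u => ([tuple (0 : measurableTypeR R) | _ < D], u.2))).
  apply: avg_ge0 => S; apply: avg_ge0 => u; rewrite mulr_ge0//.
  by apply: prodr_ge0 => i _; exact: sample_likelihood_ge0.
set inf := ereal_inf _.
pose c : R := #|{: subsets}|%:R^-1; have c0 : 0 <= c by rewrite invr_ge0.
pose win (S : subsets) := [set x | S = mb_output alg x].
have mwin S : measurable (win S) by exact: measurable_mb_output.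
pose g (S : subsets) x : \bar R := (c * \1_(win S) x)%:E.
have g0 S x : (0 <= g S x)%E by rewrite lee_fin mulr_ge0// indicE ler0n.
have mg S : measurable_fun [set: N.-tuple (features R D * bool)] (g S).
  by apply/measurable_EFinP; apply: measurable_funM => //; exact: measurable_indic.
have w0 (S : subsets) u : 0 <= sample_weight Lam S u.
  apply: mulr_ge0; first by rewrite invr_ge0.
  exact: sample_likelihood_ge0.
apply: (@le_trans _ _ (\sum_S \int[parity_data Lam S N]_x g S x)%E).
  have -> : inf = (\sum_(S : subsets) c%:E * inf)%E.
    rewrite -ge0_sume_distrl; last by move=> S _; rewrite lee_fin.
    rewrite sumEFin sumr_const -[c *+ _]mulr_natl mulfV ?mul1e//.
    by rewrite pnatr_eq0; apply/eqP => /card0_eq/(_ finset.set0).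
  apply: lee_sum => S _.
  have -> : (\int[parity_data Lam S N]_x g S x = c%:E * parity_data Lam S N (win S))%E.
    under eq_integral do rewrite /g EFinM.
    rewrite ge0_integralZl//; last first.
      by apply/measurable_EFinP; exact: measurable_indic.
    by rewrite integral_indic// setIT.
  by apply: lee_wpmul2l; rewrite ?lee_fin//; apply: ereal_inf_lbound; exists S.
have PE (S : subsets) A (mA : measurable A) := parity_sampleE S Lam01 mA.
apply: (iid_sum_le w0 PE) => // z.
pose phi i u := signed_sample u (z i).
apply: le_trans (_ : (avg (fun S => avg (fun u : {ffun 'I_N -> sample} =>
      (\prod_i sample_likelihood Lam S (u i)) *
      (mb_output alg (sample_tuple phi u) == S)%:R)))%:E <= _)%E; last first.
  by rewrite lee_fin; exact: hB.
rewrite [avg _ in leRHS]/avg -/c mulr_sumr -sumEFin; apply: lee_sum => S _.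
rewrite [avg _]/avg !mulr_sumr -sumEFin; apply: lee_sum => u _.
rewrite /g -EFinM lee_fin mulrCA ler_wpM2l// mulrA.
rewrite /sample_weight big_split/= prodr_const exprVn card_ffun natrX.
rewrite indicE le_eqVlt; apply/orP; left; apply/eqP; congr (_ * (nat_of_bool _)%:R).
apply/idP/idP; first by rewrite inE /win/= => ->; rewrite eqxx.
by move=> /eqP h; rewrite inE /win/= -h.
Qed.

End success_bound.

(** * Asymptotics *)

Import numFieldNormedType.Exports.

Section asymptotic_tools.
Context {R : realType}.

(** Where [b D = 0 < a D] the quotient is [+oo], which a finite limit superior
excludes for large [D]. *)
Lemma asymp_le_eventually (a b : nat -> R) : (forall D, 0 <= a D) -> (forall D, 0 <= b D) ->
  asymp_le a b -> exists2 C : R, 0 < C & \forall D \near \oo, a D <= C * b D.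
Proof.
move=> a0 b0 /ereal_inf_lt[_ [V nV <-] supV].
have [C C0 VC] : exists2 C : R, 0 < C &
    forall D, V D -> ((a D)%:E / (b D)%:E <= C%:E)%E.
  exists (Num.max 1 (fine (ereal_sup [set (a D)%:E / (b D)%:E | D in V]%E))).
    by rewrite lt_max ltr01.
  move=> D VD; set M := ereal_sup _ in supV *.
  have aM : ((a D)%:E / (b D)%:E <= M)%E by apply: ereal_sup_ubound; exists D.
  apply: le_trans aM _; case: M supV => [r _|//|_]; last exact: leNye.
  by rewrite lee_fin le_max lexx orbT.
exists C => //; apply: filterS nV => D /VC.
have [bD|bD] := eqVneq (b D) 0.
  rewrite bD mulr0 inve0; have [aD|aD] := eqVneq (a D) 0; first by rewrite aD.
  by rewrite gt0_muley ?lte_fin ?lt0r ?aD ?a0// leye_eq.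
have bD0 : 0 < b D by rewrite lt0r bD b0.
by rewrite inver (negbTE bD) -EFinM lee_fin ler_pdivrMr.
Qed.

Lemma powR_near (e A : R) : 0 < e -> \forall D \near \oo, A <= D%:R `^ e.
Proof.
move=> e0; near=> D.
have A1 : 0 < `|A| + 1 by rewrite ltr_wpDl.
apply: (@le_trans _ _ (((`|A| + 1) `^ e^-1) `^ e)).
  rewrite -powRrM mulVf ?gt_eqF// powRr1 ?(ltW A1)//.
  by rewrite (le_trans (ler_norm A))// lerDl.
apply: ge0_ler_powR; rewrite ?nnegrE ?powR_ge0 ?(ltW e0)//.
near: D; exact: nbhs_infty_ger.
Unshelve. all: by end_near. Qed.

(** With [j = q %/ k], [2 ^ q >= (2 ^ j) ^ k >= j.+1 ^ k >= (q / k) ^ k]. *)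
Lemma pow_half_le (k q : nat) : (0 < k)%N -> (0 < q)%N ->
  2^-1 ^+ q <= (k%:R / q%:R) ^+ k :> R.
Proof.
move=> k0 q0; set j := (q %/ k)%N.
have qk : (q <= k * (j.+1))%N by rewrite mulnC ltnW// ltn_ceil.
have jk : (j * k <= q)%N by exact: leq_trunc_div.
have h : (q%:R / k%:R : R) ^+ k <= 2 ^+ q.
  apply: (@le_trans _ _ (2 ^+ (j * k))); last by rewrite ler_eXn2l// ltr1n.
  rewrite exprM lerXn2r ?nnegrE ?divr_ge0 ?exprn_ge0//.
  rewrite ler_pdivrMr ?ltr0n// -natrX -natrM ler_nat.
  by rewrite (leq_trans qk)// mulnC leq_mul2r ltn_expl// orbT.
rewrite -invf_div exprVn exprVn lef_pV2 ?posrE ?exprn_gt0 ?divr_gt0 ?ltr0n//.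
Qed.

Lemma pow_half_le_powR (a e c : R) : 0 < e -> 0 < c ->
  exists2 K : R, 0 < K & forall (x : R) (q : nat), 1 <= x -> c * x `^ e <= q%:R ->
    2^-1 ^+ q <= K * x `^ (- a).
Proof.
move=> e0 c0; pose k := (Num.truncn (`|a| / e)).+1.
have ka : a <= e * k%:R.
  rewrite mulrC -ler_pdivrMr//; apply: (@le_trans _ _ (`|a| / e)).
    by rewrite ler_wpM2r ?invr_ge0 ?(ltW e0)// ler_norm.
  by apply: ltW; exact: truncnS_gt.
have k0 : 0 < k%:R :> R by rewrite ltr0n.
exists ((k%:R / c) ^+ k) => [|x q x1 xq]; first by rewrite exprn_gt0// divr_gt0.
have x0 : 0 < x by exact: lt_le_trans x1.
have xe0 : 0 < x `^ e by exact: powR_gt0.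
have q0 : 0 < q%:R :> R by rewrite (lt_le_trans _ xq)// mulr_gt0.
apply: le_trans (pow_half_le (ltn0Sn _) _) _; first by rewrite -(ltr0n R).
apply: (@le_trans _ _ ((k%:R / (c * x `^ e)) ^+ k)).
  apply: lerXn2r; rewrite ?nnegrE ?divr_ge0 ?(ltW q0) ?mulr_ge0 ?(ltW c0) ?(ltW xe0)//.
  by rewrite ler_pM2l// lef_pV2 ?posrE ?mulr_gt0.
rewrite invfM mulrA exprMn ler_wpM2l ?exprn_ge0 ?divr_ge0 ?(ltW c0)//.
by rewrite -powRN -powR_mulrn ?powR_ge0// -powRrM ler_powR// mulNr lerN2.
Qed.

Lemma block_error_le (D n b : nat) (Lam : R) : n%:R * Lam ^+ 2 <= 1 ->
  block_error D n Lam (2 ^ b) <=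
  32 * (Lam ^+ 2 * b%:R) + 2 * ((n ^ 4)%:R * 2^-1 ^+ D)
  + 2 * (expR 1 * (n%:R * Lam ^+ 2) ^+ 3).
Proof.
move=> nL; rewrite /block_error lerD2r mulrDr lerD2r.
have lnb : ln (2 ^ b)%:R <= b%:R :> R.
  rewrite natrX lnXn// -[leLHS]mulr_natr ler_piMl//.
  by apply: (@le_ln1Dx R 1); lra.
have L0 := sqr_ge0 Lam.
have nL4 : n%:R * Lam ^+ 4 <= Lam ^+ 2.
  by rewrite (exprD Lam 2 2) mulrA ler_piMl.
rewrite (_ : 32 * _ = 2 * (8 * (2 * Lam ^+ 2) * b%:R)); last by ring.
rewrite ler_wpM2l//; apply: ler_pM => //.
- by rewrite mulr_ge0// addr_ge0// mulr_ge0// exprn_even_ge0.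
- by rewrite ln_ge0// ler1n expn_gt0.
- by rewrite ler_wpM2l//; lra.
Qed.

End asymptotic_tools.

Section resources.
Context {R : realType}.

(** The upper bound on [Lam ^+ 2] serves for [alpha <= 0], the lower one for
[alpha > 0]. *)
Lemma inv_powR_snr (gamma alpha C x Lam : R) : 1 <= C -> 0 < x -> 0 < Lam ->
  Lam ^+ 2 <= C * x `^ (- gamma) -> x `^ (- gamma) <= C * Lam ^+ 2 ->
  (Lam `^ alpha)^-1 <= C `^ (`|alpha| / 2) * x `^ (alpha * gamma / 2).
Proof.
move=> C1 x0 L0 up lo; have C0 : 0 < C by lra.
have xg0 : 0 < x `^ (- gamma) by exact: powR_gt0.
have L2 : 0 < Lam ^+ 2 by rewrite exprn_gt0.
have LamE r : Lam `^ (2 * r) = (Lam ^+ 2) `^ r.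
  by rewrite powRrM powR_mulrn// ltW.
rewrite -powRN (_ : - alpha = 2 * (- (alpha / 2))); last by field.
rewrite LamE; case: (leP alpha 0) => a0.
  have b0 : 0 <= - (alpha / 2) by lra.
  rewrite ler0_norm//; apply: (@le_trans _ _ ((C * x `^ (- gamma)) `^ (- (alpha / 2)))).
    by apply: ge0_ler_powR; rewrite ?nnegrE// ltW// mulr_gt0.
  rewrite powRM ?(ltW C0) ?(ltW xg0)// -powRrM.
  rewrite (_ : - gamma * - (alpha / 2) = alpha * gamma / 2); last by field.
  by rewrite mulNr.
have b0 : 0 <= alpha / 2 by lra.
rewrite gtr0_norm// powRN.
have h : (C^-1 * x `^ (- gamma)) `^ (alpha / 2) <= (Lam ^+ 2) `^ (alpha / 2).
  apply: ge0_ler_powR; rewrite ?nnegrE ?(ltW L2)//.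
    by rewrite mulr_ge0 ?invr_ge0 ?(ltW C0) ?(ltW xg0).
  by rewrite ler_pdivrMl.
have p0 : 0 < (C^-1 * x `^ (- gamma)) `^ (alpha / 2).
  by rewrite powR_gt0// mulr_gt0// invr_gt0.
apply: (@le_trans _ _ ((C^-1 * x `^ (- gamma)) `^ (alpha / 2))^-1).
  rewrite lef_pV2 ?posrE// powR_gt0//.
rewrite powRM ?invr_ge0 ?(ltW C0) ?(ltW xg0)// -powRrM invfM.
rewrite -[C^-1]powR_inv1 ?(ltW C0)// -powRrM -!powRN.
rewrite (_ : - (-1 * (alpha / 2)) = alpha / 2); last by field.
by rewrite (_ : - (- gamma * (alpha / 2)) = alpha * gamma / 2)//; field.
Qed.

Lemma truncn_half (y : R) : 1 <= y ->
  [/\ (0 < Num.truncn y)%N, (Num.truncn y)%:R <= y & y / 2 <= (Num.truncn y)%:R].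
Proof.
move=> y1; have y0 : 0 <= y by lra.
have t0 : (0 < Num.truncn y)%N by rewrite truncn_gt0.
split=> //; first by rewrite truncn_le.
have := truncnS_gt y; rewrite -natr1.
have : 1 <= (Num.truncn y)%:R :> R by rewrite ler1n.
lra.
Qed.

Section fixed_dimension.
Variables (gamma eta tau mu alpha C : R).
Hypotheses (C1 : 1 <= C) (gamma0 : 0 < gamma) (eta1 : 1 <= eta).
Variables (D N T s : nat) (Lam : R).
Let x : R := D%:R.
Hypothesis x1 : 1 <= x.
Hypothesis Lam0 : 0 < Lam.
Hypotheses (snr_le : Lam ^+ 2 <= C * x `^ (- gamma))
           (snr_ge : x `^ (- gamma) <= C * Lam ^+ 2).
Hypothesis N_le : N%:R * Lam ^+ 2 <= C * x `^ eta.
Hypotheses (T_le : T%:R <= C * x `^ tau) (T_gt0 : (0 < T)%N).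
Hypotheses (s_le : s%:R <= C * (x `^ mu / Lam `^ alpha)) (s_gt0 : (0 < s)%N).

(** Of order [Lam] to the power [- (4 / 3)]: the scale at which the contribution
[(n * Lam ^+ 2) ^+ 3] of the degrees three and more is comparable with
[Lam ^+ 2]. *)
Definition block_size : nat := Num.truncn (x `^ (2 * gamma / 3)).
Definition block_count : nat := (N %/ block_size).+1.
(** Small enough for the negative moments of order [q] of a block likelihood to
stay bounded, yet [2 ^- q] decays faster than any power of [D]. *)
Definition moment_order : nat := Num.truncn ((2 * C)^-1 * x `^ (gamma / 6)).

Local Notation n := block_size.
Local Notation m := block_count.
Local Notation q := moment_order.
Local Notation rho := (eta + gamma / 3).

Let x0 : 0 < x. Proof. exact: lt_le_trans x1. Qed.
Let C0 : 0 < C. Proof. exact: lt_le_trans C1. Qed.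
Let powD a b : x `^ (a + b) = x `^ a * x `^ b.
Proof. by rewrite powRD//; apply/implyP => _; rewrite gt_eqF. Qed.
Let pow_ge1 a : 0 <= a -> 1 <= x `^ a.
Proof. by move=> a0; rewrite -(powRr0 x) ler_powR. Qed.
Let pow_gt0 a : 0 < x `^ a. Proof. exact: powR_gt0. Qed.
Let L2 : 0 < Lam ^+ 2. Proof. by rewrite exprn_gt0. Qed.

Lemma block_size_half : [/\ (0 < n)%N, n%:R <= x `^ (2 * gamma / 3) &
  x `^ (2 * gamma / 3) / 2 <= n%:R].
Proof. by apply: truncn_half; apply: pow_ge1; have := gamma0; lra. Qed.

Lemma block_signal_le : n%:R * Lam ^+ 2 <= C * x `^ (- (gamma / 3)).
Proof.
have [n0 nx _] := block_size_half.
apply: (@le_trans _ _ (x `^ (2 * gamma / 3) * (C * x `^ (- gamma)))).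
  by apply: ler_pM => //; exact: ltW.
rewrite mulrCA -powD (_ : 2 * gamma / 3 + - gamma = - (gamma / 3))//; by field.
Qed.

Lemma block_count_mul : (N <= m * n)%N.
Proof. by have [n0 _ _] := block_size_half; rewrite ltnW// ltn_ceil. Qed.

Lemma block_count_le : m%:R <= (1 + 2 * C ^+ 2) * x `^ rho.
Proof.
have [n0 _ nx] := block_size_half; have n0R : 0 < n%:R :> R by rewrite ltr0n.
have xr : 1 <= x `^ rho by apply: pow_ge1; have := gamma0; have := eta1; lra.
have NC : N%:R <= C ^+ 2 * x `^ (eta + gamma).
  rewrite -(ler_pM2r L2); apply: le_trans N_le _.
  rewrite powD (_ : _ * _ * _ = C * x `^ eta * (C * Lam ^+ 2 * x `^ gamma)); last by ring.
  rewrite ler_peMr ?mulr_ge0 ?(ltW C0) ?(ltW (pow_gt0 _))//.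
  by rewrite -ler_pdivrMr// mul1r -powRN.
have NnC : (N %/ n)%:R <= 2 * C ^+ 2 * x `^ rho.
  apply: (@le_trans _ _ (N%:R / n%:R)).
    by rewrite ler_pdivlMr// -natrM ler_nat leq_trunc_div.
  rewrite ler_pdivrMr//; apply: le_trans NC _.
  apply: (@le_trans _ _ (2 * C ^+ 2 * x `^ rho * (x `^ (2 * gamma / 3) / 2))); last first.
    by rewrite ler_wpM2l// mulr_ge0 ?(ltW (pow_gt0 _))// mulr_ge0// sqr_ge0.
  rewrite (_ : eta + gamma = rho + 2 * gamma / 3); last by field.
  by rewrite powD le_eqVlt; apply/orP; left; apply/eqP; field.
by rewrite /block_count -natr1 mulrDl mul1r addrC; apply: lerD.
Qed.

Lemma signal_bits_le : Lam ^+ 2 * (s * T)%:R <=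
  C ^+ 3 * C `^ (`|alpha| / 2) * x `^ (tau + mu + alpha * gamma / 2 - gamma).
Proof.
have h := inv_powR_snr alpha C1 x0 Lam0 snr_le snr_ge.
apply: (@le_trans _ _ ((C * x `^ (- gamma)) *
  ((C * (x `^ mu * (C `^ (`|alpha| / 2) * x `^ (alpha * gamma / 2)))) * (C * x `^ tau)))).
  apply: ler_pM => //; first exact: ltW.
  rewrite natrM; apply: ler_pM => //.
  apply: le_trans s_le _; apply: ler_wpM2l; first exact: ltW.
  by apply: ler_wpM2l => //; exact: ltW.
rewrite !powD le_eqVlt; apply/orP; left; apply/eqP; ring.
Qed.

Hypothesis gap : eta + tau + mu + 2 < gamma * (4 / 3 - alpha) / 2.
Variables (K1 K2 : R).
Hypothesis half_D : 2^-1 ^+ D <= K1 * x `^ (- (rho + 8 * gamma / 3 + 1)).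
Hypothesis half_q : 2^-1 ^+ q <= K2 * x `^ (- (rho + 1)).
Hypothesis small_block : C <= x `^ (gamma / 3).

Let Cm := 1 + 2 * C ^+ 2.
Let Ca := C `^ (`|alpha| / 2).

Lemma block_signal_le1 : n%:R * Lam ^+ 2 <= 1.
Proof.
apply: le_trans block_signal_le _.
by rewrite powRN ler_pdivrMr// mul1r.
Qed.

Definition rate_constant : R :=
  Cm * (2 * (32 + 2 * expR 1 * C ^+ 4) * (C ^+ 3 * Ca) + 4 * K1 + 2 * expR 2 * K2).

(** The bits sent about all the blocks cost
[x `^ (eta + tau + mu - gamma * (4 / 3 - alpha) / 2)], whose exponent is below
[-1] by [gap]; the degrees three and more cost a constant multiple of this.
Coincidences between features and the tail of the likelihood are smaller than
any power of [x]. *)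
Lemma total_error_le :
  m%:R * (2 * block_error D n Lam (2 ^ (s * T)) + 2 * 2^-1 ^+ q * expR 2) <=
  rate_constant / x.
Proof.
(* The block parameters become variables, so that no conversion test evaluates
   their truncations. *)
move: half_q block_signal_le1 block_signal_le block_count_le block_size_half.
move: moment_order block_count block_size => q m n hq nL nS mC [n0 nx _].
have Cm0 : 0 <= Cm by rewrite addr_ge0// mulr_ge0// sqr_ge0.
have Ca0 : 0 <= Ca by exact: powR_ge0.
have xm1 : x^-1 = x `^ (-1) by rewrite powR_inv1// ltW.
have b1 : 1 <= (s * T)%:R :> R by rewrite ler1n muln_gt0 s_gt0.
set b := (s * T)%N; set L := Lam ^+ 2.
(* Since at least one bit is sent, the degree-three term is absorbed by the
   term counting bits. *)
have cube : (n%:R * L) ^+ 3 <= C ^+ 4 * (L * b%:R).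
  apply: (@le_trans _ _ ((C * x `^ (- (gamma / 3))) ^+ 3)).
    apply: lerXn2r; last exact: nS.
      by rewrite nnegrE mulr_ge0// ltW.
    by rewrite nnegrE mulr_ge0// ltW.
  rewrite exprMn -(powR_mulrn 3 (ltW (pow_gt0 _))) -powRrM.
  rewrite (_ : - (gamma / 3) * 3 = - gamma); last by field.
  rewrite (_ : C ^+ 4 * (L * b%:R) = C ^+ 3 * (C * (L * b%:R))); last by ring.
  apply: ler_wpM2l.
    by rewrite exprn_ge0// ltW.
  apply: le_trans snr_ge _; rewrite ler_wpM2l ?(ltW C0)//.
  by rewrite ler_peMr// ltW.
have BE : block_error D n Lam (2 ^ b) <=
    (32 + 2 * expR 1 * C ^+ 4) * (L * b%:R) + 2 * ((n ^ 4)%:R * 2^-1 ^+ D).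
  apply: le_trans (block_error_le D b nL) _.
  have := ler_wpM2l (mulr_ge0 (ler0n R 2) (expR_ge0 1)) cube; rewrite -/L; lra.
have t1 : m%:R * (L * b%:R) <= Cm * (C ^+ 3 * Ca) / x.
  apply: (@le_trans _ _ ((Cm * x `^ rho) * (C ^+ 3 * Ca *
      x `^ (tau + mu + alpha * gamma / 2 - gamma)))).
    by apply: ler_pM => //; [rewrite mulr_ge0// ltW|exact: signal_bits_le].
  rewrite mulrACA -powD xm1 ler_wpM2l ?mulr_ge0 ?exprn_ge0 ?(ltW C0)//.
  by rewrite ler_powR//; have := gap; lra.
have t2 : m%:R * ((n ^ 4)%:R * 2^-1 ^+ D) <= Cm * K1 / x.
  apply: (@le_trans _ _ ((Cm * x `^ rho) * (x `^ (8 * gamma / 3) *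
      (K1 * x `^ (- (rho + 8 * gamma / 3 + 1)))))).
    have h0 : 0 <= 2^-1 ^+ D :> R by rewrite exprn_ge0// invr_ge0.
    apply: ler_pM; [by []|by apply: mulr_ge0|exact: mC|].
    apply: ler_pM => //.
    rewrite natrX (_ : 8 * gamma / 3 = 2 * gamma / 3 * 4); last by field.
    by rewrite powRrM powR_mulrn ?(ltW (pow_gt0 _))// lerXn2r ?nnegrE ?(ltW (pow_gt0 _)).
  rewrite xm1 (_ : -1 = rho + (8 * gamma / 3 + - (rho + 8 * gamma / 3 + 1))); last by ring.
  by rewrite (powD rho) (powD (8 * gamma / 3)) le_eqVlt; apply/orP; left; apply/eqP; ring.
have t3 : m%:R * 2^-1 ^+ q <= Cm * K2 / x.
  apply: (@le_trans _ _ ((Cm * x `^ rho) * (K2 * x `^ (- (rho + 1))))).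
    have h0 : 0 <= 2^-1 ^+ q :> R by rewrite exprn_ge0// invr_ge0.
    exact: ler_pM.
  rewrite xm1 (_ : -1 = rho + - (rho + 1)); last by ring.
  by rewrite (powD rho) le_eqVlt; apply/orP; left; apply/eqP; ring.
set c := 32 + 2 * expR 1 * C ^+ 4 in BE *.
have c0 : 0 <= c by rewrite addr_ge0// !mulr_ge0 ?expR_ge0 ?exprn_ge0 ?(ltW C0).
apply: (@le_trans _ _ (2 * c * (m%:R * (L * b%:R)) +
    4 * (m%:R * ((n ^ 4)%:R * 2^-1 ^+ D)) + 2 * expR 2 * (m%:R * 2^-1 ^+ q))).
  rewrite [leRHS](_ : _ = m%:R * (2 * (c * (L * b%:R) + 2 * ((n ^ 4)%:R * 2^-1 ^+ D)) +
     2 * 2^-1 ^+ q * expR 2)); last by ring.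
  by rewrite ler_wpM2l// lerD2r ler_wpM2l.
rewrite /rate_constant -/c.
rewrite [leRHS](_ : _ = 2 * c * (Cm * (C ^+ 3 * Ca) / x) +
   4 * (Cm * K1 / x) + 2 * expR 2 * (Cm * K2 / x)); last by move: (x^-1) => y; ring.
by rewrite !lerD// ler_wpM2l// mulr_ge0// expR_ge0.
Qed.

Lemma moment_order_le : (q%:R * Lam) ^+ 2 * n%:R <= 4^-1.
Proof.
have qx : q%:R <= (2 * C)^-1 * x `^ (gamma / 6).
  by rewrite truncn_le mulr_ge0 ?invr_ge0 ?mulr_ge0 ?(ltW C0) ?(ltW (pow_gt0 _)).
apply: (@le_trans _ _ (((2 * C)^-1 * x `^ (gamma / 6)) ^+ 2 * (C * x `^ (- (gamma / 3))))).
  move: block_signal_le qx; move: moment_order block_size => q n nS qx.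
  rewrite (_ : _ * n%:R = q%:R ^+ 2 * (n%:R * Lam ^+ 2)); last by rewrite exprMn; ring.
  apply: ler_pM; [exact: sqr_ge0|by apply: mulr_ge0 => //; exact: ltW| |exact: nS].
  apply: lerXn2r => //; rewrite nnegrE ?ler0n//.
  by apply: mulr_ge0; rewrite ?invr_ge0 ?mulr_ge0 ?(ltW C0) ?(ltW (pow_gt0 _)).
rewrite exprMn -(powR_mulrn 2 (ltW (pow_gt0 _))) -powRrM.
rewrite (_ : gamma / 6 * 2 = gamma / 3); last by field.
rewrite mulrACA -powD subrr powRr0 mulr1.
rewrite [leLHS](_ : _ = 4^-1 * C^-1); last by field; rewrite gt_eqF.
by rewrite ler_piMr// invf_le1.
Qed.

End fixed_dimension.
End resources.

Section rate.
Context {R : realType}.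
Variables (gamma eta tau mu alpha : R).
Variables (Lambda : nat -> R) (N T s : nat -> nat).
Variable S_hat : forall D : nat,
  mb_algorithm (features R D * bool)%type {set 'I_D} (N D) (T D) (s D).
Hypothesis Lambda01 : forall D : nat, 0 <= Lambda D <= 1.
Hypotheses (eta1 : 1 <= eta) (tau0 : 0 <= tau) (mu0 : 0 <= mu) (alpha43 : alpha < 4 / 3).
Hypotheses
  (snrE : asymp_eq (fun D => Lambda D ^+ 2) (fun D => D%:R `^ (- gamma)))
  (NE : asymp_eq (fun D => (N D)%:R * Lambda D ^+ 2) (fun D => D%:R `^ eta))
  (TE : asymp_eq (fun D => (T D)%:R) (fun D => D%:R `^ tau))
  (sE : asymp_eq (fun D => (s D)%:R) (fun D => D%:R `^ mu / Lambda D `^ alpha)).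
Hypothesis gap : 2 * (eta + tau + mu + 2) / (4 / 3 - alpha) < gamma.

Local Notation worst D := (ereal_inf [set parity_data (Lambda D) S (N D)
  [set x | S = mb_output (S_hat D) x] | S in [set: {set 'I_D}]]).

Lemma worst_success_rate : exists2 K : R, 0 < K &
  \forall D \near \oo, forall eps : R, 0 < eps ->
    (worst D <= (D%:R^-1 + eps + eps^-1 * (K / D%:R))%:E)%E.
Proof.
have d0 : 0 < 4 / 3 - alpha by have := alpha43; lra.
have gap' : eta + tau + mu + 2 < gamma * (4 / 3 - alpha) / 2.
  by move: gap; rewrite ltr_pdivrMr//; lra.
have gamma0 : 0 < gamma.
  apply: lt_trans gap; rewrite divr_gt0// mulr_gt0//.
  by have := eta1; have := tau0; have := mu0; lra.
have pr (r : R) (D : nat) : 0 <= D%:R `^ r by exact: powR_ge0.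
have sq D : 0 <= Lambda D ^+ 2 by exact: sqr_ge0.
have nat0 (f : nat -> nat) D : 0 <= (f D)%:R :> R by [].
have NL0 D : 0 <= (N D)%:R * Lambda D ^+ 2 by rewrite mulr_ge0.
have sl0 D : 0 <= D%:R `^ mu / Lambda D `^ alpha by rewrite divr_ge0 ?powR_ge0.
have [c1 c10 h1] := asymp_le_eventually sq (pr _) snrE.1.
have [c2 c20 h2] := asymp_le_eventually (pr _) sq snrE.2.
have [c3 c30 h3] := asymp_le_eventually NL0 (pr _) NE.1.
have [c4 c40 h4] := asymp_le_eventually (nat0 T) (pr _) TE.1.
have [c5 c50 h5] := asymp_le_eventually (pr _) (nat0 T) TE.2.
have [c6 c60 h6] := asymp_le_eventually (nat0 s) sl0 sE.1.
have [c7 c70 h7] := asymp_le_eventually sl0 (nat0 s) sE.2.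
pose C := 1 + c1 + c2 + c3 + c4 + c5 + c6 + c7.
have C1 : 1 <= C by rewrite /C; lra.
have C0 : 0 < C by lra.
have [K1 K10 hK1] := @pow_half_le_powR R (eta + gamma / 3 + 8 * gamma / 3 + 1) 1 1 ltr01 ltr01.
have g6 : 0 < gamma / 6 by rewrite divr_gt0.
have g3 : 0 < gamma / 3 by rewrite divr_gt0.
have iC : 0 < (2 * C)^-1 / 2 by rewrite divr_gt0// invr_gt0 mulr_gt0.
have [K2 K20 hK2] := pow_half_le_powR (eta + gamma / 3 + 1) g6 iC.
exists (rate_constant alpha C K1 K2).
  rewrite /rate_constant.
  have ha : 0 <= C `^ (`|alpha| / 2) by exact: powR_ge0.
  have e1 := expR_ge0 (1 : R); have e2 := expR_ge0 (2 : R).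
  apply: mulr_gt0; first by rewrite ltr_wpDr// mulr_ge0// sqr_ge0.
  apply: ltr_wpDr; first by rewrite !mulr_ge0// ltW.
  apply: ltr_wpDl; last by rewrite mulr_gt0.
  by rewrite !mulr_ge0 ?addr_ge0 ?mulr_ge0 ?exprn_ge0// ltW.
near=> D => eps eps0.
have x1 : 1 <= D%:R :> R by near: D; exact: nbhs_infty_ger.
have x0 : 0 < D%:R :> R by lra.
have enlarge (c a b : R) : c <= C -> 0 <= b -> a <= c * b -> a <= C * b.
  by move=> cC b0 h; apply: le_trans h _; apply: ler_wpM2r.
have H1 : Lambda D ^+ 2 <= C * D%:R `^ (- gamma).
  by apply: (@enlarge c1); [rewrite /C; lra|exact: powR_ge0|near: D].
have H2 : D%:R `^ (- gamma) <= C * Lambda D ^+ 2.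
  by apply: (@enlarge c2); [rewrite /C; lra|exact: sqr_ge0|near: D].
have H3 : (N D)%:R * Lambda D ^+ 2 <= C * D%:R `^ eta.
  by apply: (@enlarge c3); [rewrite /C; lra|exact: powR_ge0|near: D].
have H4 : (T D)%:R <= C * D%:R `^ tau.
  by apply: (@enlarge c4); [rewrite /C; lra|exact: powR_ge0|near: D].
have H5 : D%:R `^ tau <= c5 * (T D)%:R by near: D.
have H6 : (s D)%:R <= C * (D%:R `^ mu / Lambda D `^ alpha).
  by apply: (@enlarge c6); [rewrite /C; lra|exact: sl0|near: D].
have H7 : D%:R `^ mu / Lambda D `^ alpha <= c7 * (s D)%:R by near: D.
have xg : C < D%:R `^ gamma.
  apply: (@lt_le_trans _ _ (C + 1)); first lra.
  by near: D; exact: powR_near.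
have xg3 : C <= D%:R `^ (gamma / 3) by near: D; exact: powR_near.
have xg6 : 2 * C <= D%:R `^ (gamma / 6) by near: D; exact: powR_near.
have L0 : 0 < Lambda D.
  case/andP: (Lambda01 D) => L0 _; rewrite lt0r L0 andbT; apply/eqP => LD.
  by move: H2; rewrite LD expr0n mulr0 leNgt powR_gt0.
have L1 : Lambda D < 1.
  case/andP: (Lambda01 D) => _ L1; rewrite lt_neqAle L1 andbT; apply/eqP => LD.
  move: H1; rewrite LD expr1n powRN -ler_pdivrMr ?invr_gt0 ?powR_gt0//.
  by rewrite invrK mul1r leNgt xg.
(* The lower asymptotic bounds on [T] and [s] exclude the value 0. *)
have T0 : (0 < T D)%N.
  rewrite lt0n; apply/eqP => TD; move: H5.
  by rewrite TD mulr0 leNgt powR_gt0.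
have s0 : (0 < s D)%N.
  rewrite lt0n; apply/eqP => sD; move: H7.
  by rewrite sD mulr0 leNgt divr_gt0 ?powR_gt0.
have hD : 2^-1 ^+ D <= K1 * D%:R `^ (- (eta + gamma / 3 + 8 * gamma / 3 + 1)).
  by apply: hK1 => //; rewrite mul1r powRr1.
have [q0 _ q2] : [/\ (0 < moment_order gamma C D)%N,
    (moment_order gamma C D)%:R <= (2 * C)^-1 * D%:R `^ (gamma / 6) &
    (2 * C)^-1 * D%:R `^ (gamma / 6) / 2 <= (moment_order gamma C D)%:R].
  by apply: truncn_half; rewrite mulrC ler_pdivlMr ?mulr_gt0// mul1r.
have hq : 2^-1 ^+ moment_order gamma C D <= K2 * D%:R `^ (- (eta + gamma / 3 + 1)).
  by apply: hK2 => //; rewrite mulrAC.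
have err := total_error_le C1 gamma0 eta1 x1 L0 H1 H2 H3 H4 T0 H6 s0 gap' hD hq xg3.
have [n0 _ _] := block_size_half gamma0 x1.
have nL := block_signal_le1 gamma0 x1 L0 H1 xg3.
have qn := moment_order_le C1 gamma0 x1 L0 H1.
have Nmn := block_count_mul gamma0 (N D) x1.
have m0 : (0 < block_count gamma D (N D))%N by [].
move: err n0 nL qn Nmn q0 m0.
move: (moment_order gamma C D) (block_count gamma D (N D)) (block_size gamma D).
move=> q m n err n0 nL qn Nmn q0 m0.
have qL : q%:R * Lambda D <= 2^-1.
  rewrite -(@ler_pXn2r _ 2) ?nnegrE ?invr_ge0 ?mulr_ge0 ?(ltW L0)//.
  have -> : (2^-1 : R) ^+ 2 = 4^-1 by field.
  apply: le_trans qn.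
  by rewrite ler_peMr ?sqr_ge0// ler1n.
have qn1 : (q%:R * Lambda D) ^+ 2 * n%:R <= 1.
  by apply: le_trans qn _; rewrite invf_le1// ler1n.
have D2 : 2^-1 ^+ D <= D%:R^-1 :> R.
  rewrite exprVn lef_pV2 ?posrE ?exprn_gt0// -natrX ler_nat.
  by rewrite ltnW// ltn_expl.
have L01 : 0 < Lambda D < 1 by rewrite L0.
apply: le_trans (worst_success_le (B := 2^-1 ^+ D + eps + eps^-1 * (m%:R *
     (2 * block_error D n (Lambda D) (2 ^ (s D * T D)) + 2 * 2^-1 ^+ q * expR 2))) _ _) _.
- exact: Lambda01.
- move=> phi; exact: mb_success_le.
rewrite lee_fin lerD// ?lerD2r//.
by rewrite ler_wpM2l ?invr_ge0 ?(ltW eps0).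
Unshelve. all: by end_near. Qed.

(** Take [eps] equal to the inverse square root of [D] in [worst_success_rate]. *)
Lemma worst_success_cvg0 : worst D @[D --> \oo] --> 0%E.
Proof.
have [K K0 hK] := worst_success_rate.
pose h (D : nat) : R := (2 + K) * D%:R `^ (- 2^-1).
apply: (@squeeze_cvge _ _ _ _ (fun=> 0%E) _ (fun D => (h D)%:E)).
- near=> D; apply/andP; split.
    by apply: le_ereal_inf_tmp => _ [S _ <-]; exact: measure_ge0.
  have D0 : 0 < D%:R :> R by near: D; exact: nbhs_infty_gtr.
  have D1 : 1 <= D%:R :> R by near: D; exact: nbhs_infty_ger.
  have e0 : 0 < D%:R `^ (- 2^-1) :> R by exact: powR_gt0.
  have rate : forall eps : R, 0 < eps ->
    (worst D <= (D%:R^-1 + eps + eps^-1 * (K / D%:R))%:E)%E by near: D.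
  apply: le_trans (rate _ e0) _; rewrite lee_fin /h.
  have -> : D%:R^-1 = D%:R `^ (- 2^-1) * D%:R `^ (- 2^-1) :> R.
    rewrite -powRD; last by apply/implyP => _; rewrite gt_eqF.
    rewrite (_ : - 2^-1 - 2^-1 = -1); last by field.
    by rewrite powR_inv1// ltW.
  have e1 : D%:R `^ (- 2^-1) <= 1 :> R.
    by rewrite -[leRHS](powRr0 D%:R) ler_powR// oppr_le0 invr_ge0.
  set e := D%:R `^ _ in e0 e1 *.
  have -> : e^-1 * (K * (e * e)) = K * e by field; rewrite gt_eqF.
  have : e * e <= e by rewrite ler_piMl// ltW.
  lra.
- exact: cvg_cst.
- apply: cvg_EFin; first by near=> D.
  apply/cvgrPdist_le => eps eps0; near=> D; rewrite /= sub0r normrN.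
  have D0 : 0 < D%:R :> R by near: D; exact: nbhs_infty_gtr.
  rewrite ger0_norm; last by rewrite mulr_ge0 ?powR_ge0// addr_ge0// ltW.
  rewrite /h powRN ler_pdivrMr ?powR_gt0// mulrC -ler_pdivrMr//.
  by near: D; apply: powR_near; rewrite invr_gt0.
Unshelve. all: by end_near. Qed.

End rate.

Theorem corollary4 (R : realType)
    (gamma eta tau mu alpha : R)
    (Lambda : nat -> R) (N T s : nat -> nat)
    (S_hat : forall D : nat,
      mb_algorithm (features R D * bool)%type {set 'I_D} (N D) (T D) (s D)) :
  (forall D : nat, 0 <= Lambda D <= 1) ->
  1 <= eta -> 0 <= tau -> 0 <= mu -> alpha < 4 / 3 ->
  asymp_eq (fun D => Lambda D ^+ 2) (fun D => D%:R `^ (- gamma)) ->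
  asymp_eq (fun D => (N D)%:R * Lambda D ^+ 2) (fun D => D%:R `^ eta) ->
  asymp_eq (fun D => (T D)%:R) (fun D => D%:R `^ tau) ->
  asymp_eq (fun D => (s D)%:R) (fun D => D%:R `^ mu / Lambda D `^ alpha) ->
  2 * (eta + tau + mu + 2) / (4 / 3 - alpha) < gamma ->
  ereal_inf [set parity_data (Lambda D) S (N D)
                   [set x | S = mb_output (S_hat D) x]
            | S in [set: {set 'I_D}]] @[D --> \oo] --> 0%E.
Proof. by move=> *; apply: (@worst_success_cvg0 R gamma eta tau mu alpha Lambda N T s). Qed.
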